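(* Let $0<s<1$, $a=1-2s$, and $u\in\mathscr S(\mathbb R^n)$. Then the solution $U$ to the extension problem $$\begin{cases}\operatorname{div}_{x,y}\left(y^a\nabla_{x,y}U\right)=0, & x\in\mathbb R^n,\ y>0,\\ U(x,0)=u(x), & x\in\mathbb R^n,\\ U(x,y)\to 0\ \text{ as } y\to\infty, & x\in\mathbb R^n,\end{cases}$$ is given by $$U(x,y)=\left(P_s(\cdot,y)\star u\right)(x)=\int_{\mathbb R^n}P_s(x-z,y)\,u(z)\,dz,$$ where $$P_s(x,y)=\frac{\Gamma\left(\frac n2+s\right)}{\pi^{\frac n2}\,\Gamma(s)}\,\frac{y^{2s}}{(y^2+|x|^2)^{\frac{n+2s}{2}}}$$ is the Poisson kernel for the extension problem in the half-space $\mathbb R^{n+1}_+=\{(x,y): x\in\mathbb R^n,\ y>0\}$. For this $U$ one has $$(-\Delta)^s u(x)=-\frac{2^{2s-1}\,\Gamma(s)}{\Gamma(1-s)}\lim_{y\to 0^+}y^a\,\frac{\partial U}{\partial y}(x,y).$$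
   Context: $\mathscr S(\mathbb R^n)$ is the Schwartz space of rapidly decreasing functions, $\Gamma$ is Euler's gamma function, and $\star$ denotes convolution in $\mathbb R^n$. For $u\in\mathscr S(\mathbb R^n)$ the fractional Laplacean is $$(-\Delta)^s u(x)=\frac{\gamma(n,s)}{2}\int_{\mathbb R^n}\frac{2u(x)-u(x+y)-u(x-y)}{|y|^{n+2s}}\,dy,\qquad \gamma(n,s)=\frac{s\,2^{2s}\,\Gamma\left(\frac{n+2s}{2}\right)}{\pi^{n/2}\,\Gamma(1-s)}.$$ Equivalently, the differential equation in the extension problem reads $-\Delta_xU=\frac{\partial^2U}{\partial y^2}+\frac ay\frac{\partial U}{\partial y}$.
   Formalization: ''The solution U'' is proved to exist, be bounded, and be unique among bounded solutions continuous up to y=0; with only U(x,y)→0 as y→∞ for each x, uniqueness fails (e.g. n=1, s=1/2, via entire functions tending to 0 along every line). *)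

(* Defs.v *)
From HB Require Import structures.
From mathcomp Require Import all_boot all_order all_algebra.
From mathcomp Require Import all_classical all_reals all_analysis.

Set Implicit Arguments.
Unset Strict Implicit.
Unset Printing Implicit Defensive.

Import Order.TTheory GRing.Theory Num.Theory.
Import numFieldNormedType.Exports.

Local Open Scope classical_set_scope.
Local Open Scope ring_scope.

(* Lebesgue measure on the Borel sets of R^n, realized on n-tuples (which carry
   the product sigma-algebra): Lebesgue measure on R^(n+1) is the image of
   lebesgue_measure \x (Lebesgue measure on R^n) under (h, t) |-> h :: t. *)
Section tuple_cons_measure.
Context {R : realType} (n : nat).
Variable mu : {sigma_finite_measure set n.-tuple (measurableTypeR R) -> \bar R}.

Let consf (p : measurableTypeR R * n.-tuple (measurableTypeR R))
  : n.+1.-tuple (measurableTypeR R) := [tuple of p.1 :: p.2].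

Let measurable_consf : measurable_fun [set: _] consf.
Proof. by apply: measurable_cons. Qed.

Definition tuple_cons_measure : set (n.+1.-tuple (measurableTypeR R)) -> \bar R :=
  pushforward (@lebesgue_measure R \x mu)%E consf.

Let tuple_cons_measure0 : tuple_cons_measure set0 = 0%E.
Proof. exact: measure0. Qed.

Let tuple_cons_measure_ge0 A : (0 <= tuple_cons_measure A)%E.
Proof. exact: measure_ge0. Qed.

Let tuple_cons_measure_sigma_additive : semi_sigma_additive tuple_cons_measure.
Proof. exact: measure_semi_sigma_additive. Qed.

HB.instance Definition _ := isMeasure.Build _ _ _ tuple_cons_measure
  tuple_cons_measure0 tuple_cons_measure_ge0 tuple_cons_measure_sigma_additive.

Let tuple_cons_measure_sigma_finite : sigma_finite setT tuple_cons_measure.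
Proof.
have /sigma_finiteP[F [TF ndF Foo]] := sigma_finiteT (@lebesgue_measure R).
have /sigma_finiteP[G [TG ndG Goo]] := sigma_finiteT mu.
pose g (t : n.+1.-tuple (measurableTypeR R)) := (thead t, [tuple of behead t]).
have gK : cancel consf g.
  by move=> [h t]; rewrite /g /consf /=; congr pair; apply/val_inj.
have mg : measurable_fun [set: _] g.
  apply/measurable_fun_pair; [exact: measurable_tnth|exact: measurable_behead].
exists (fun k => g @^-1` (F k `*` G k)).
  rewrite -preimage_bigcup (_ : \bigcup_k _ = setT) ?preimage_setT//.
  apply/seteqP; split => // -[x y] _.
  have [i _ Fix] : (\bigcup_k F k) x by rewrite -TF.
  have [j _ Gjy] : (\bigcup_k G k) y by rewrite -TG.
  exists (maxn i j) => //; split => /=.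
  - by move: x Fix; exact/subsetPset/ndF/leq_maxl.
  - by move: y Gjy; exact/subsetPset/ndG/leq_maxr.
move=> k; have [mF Fk] := Foo k; have [mG Gk] := Goo k; split.
  by rewrite -[X in measurable X]setTI; apply: mg => //; exact: measurableX.
rewrite /tuple_cons_measure /pushforward -comp_preimage.
rewrite (_ : g \o consf = id); last by apply/funext => p /=; rewrite gK.
by rewrite preimage_id product_measure1E// lte_mul_pinfty// ge0_fin_numE.
Qed.

HB.instance Definition _ := Measure_isSigmaFinite.Build _ _ _
  tuple_cons_measure tuple_cons_measure_sigma_finite.

End tuple_cons_measure.

Fixpoint lebesgue_tuple (R : realType) (n : nat) :
    {sigma_finite_measure set n.-tuple (measurableTypeR R) -> \bar R} :=
  if n is m.+1 then tuple_cons_measure (lebesgue_tuple R m)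
  else \d_ ([tuple] : 0.-tuple (measurableTypeR R)).

Lemma lebesgue_tuple_box (R : realType) (n : nat)
    (A : 'I_n -> set (measurableTypeR R)) :
  (forall i, measurable (A i)) ->
  lebesgue_tuple R n [set t | forall i, A i (tnth t i)]
  = (\prod_(i < n) lebesgue_measure (A i))%E.
Proof.
elim: n A => [|n IHn] A mA.
  by rewrite big_ord0 /= diracE mem_set //= => -[].
rewrite big_ord_recl -IHn// -product_measure1E//; last first.
  rewrite [X in measurable X](_ : _ = \bigcap_(i in [set: 'I_n])
      ((fun t => tnth t i) @^-1` A (lift ord0 i))); last first.
    by apply/seteqP; split => t /= At => [i _|i]; exact: At.
  apply: fin_bigcap_measurable => // i _.
  by rewrite -[X in measurable X]setTI; apply: measurable_tnth.
rewrite /= /tuple_cons_measure /pushforward; congr product_measure1.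
apply/seteqP; split => -[h t] /=.
- move=> At; split => [|i]; first by have := At ord0; rewrite tnth0.
  by have := At (lift ord0 i); rewrite tnthS.
- case=> Ah At i; case: (unliftP ord0 i) => [j ->|->].
    by rewrite tnthS; exact: At.
  by rewrite tnth0.
Qed.

Section half_space_extension.
Context {R : realType} {n : nat}.
Implicit Types (s a y : R) (x z : 'rV[R]_n) (u f g : 'rV[R]_n -> R)
  (U V : 'rV[R]_n * R -> R).

Definition integral_Rn f : R :=
  \int[lebesgue_tuple R n]_t f (\row_i tnth t i).

Definition convolution f g x : R := integral_Rn (fun z => f (x - z) * g z).

(* The library norm `|x| on row vectors is the sup norm. *)
Definition enorm x : R := Num.sqrt (\sum_i x ord0 i ^+ 2).

(* Iterated partial derivative d_{i_1} (d_{i_2} (... (d_{i_k} u))) for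
   b = [:: i_1; ...; i_k]. *)
Definition iter_partial (b : seq 'I_n) u : 'rV[R]_n -> R :=
  foldr (fun i f => fun x => 'D_(delta_mx ord0 i) f x) u b.

Definition smooth u : Prop :=
  forall b : seq 'I_n, continuous (iter_partial b u) /\
    forall (i : 'I_n) x, derivable (iter_partial b u) x (delta_mx ord0 i).

Definition schwartz u : Prop :=
  smooth u /\
  forall (b : seq 'I_n) (k : nat), exists C : R,
    forall x, (1 + enorm x) ^+ k * `|iter_partial b u x| <= C.

Definition Gamma s : R :=
  \int[lebesgue_measure]_(t in `]0, +oo[) (t `^ (s - 1) * expR (- t)).

Definition gamma_ns s : R :=
  s * 2 `^ (2 * s) * Gamma ((n%:R + 2 * s) / 2) /
  (pi `^ (n%:R / 2) * Gamma (1 - s)).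

Definition fractional_laplacian s u x : R :=
  gamma_ns s / 2 *
  integral_Rn (fun z =>
    (2 * u x - u (x + z) - u (x - z)) / enorm z `^ (n%:R + 2 * s)).

Definition poisson_kernel s x y : R :=
  Gamma (n%:R / 2 + s) / (pi `^ (n%:R / 2) * Gamma s) *
  (y `^ (2 * s) / (y ^+ 2 + enorm x ^+ 2) `^ ((n%:R + 2 * s) / 2)).

(* Coordinate directions of R^n x R: Some i is x_i, None is y. *)
Definition direction (k : option 'I_n) : 'rV[R]_n * R :=
  if k is Some i then (delta_mx ord0 i, 0) else (0, 1).

Definition partial (k : option 'I_n) U : 'rV[R]_n * R -> R :=
  fun p => 'D_(direction k) U p.

Definition C2_upper_half_space U : Prop :=
  forall p : 'rV[R]_n * R, 0 < p.2 ->
    {for p, continuous U} /\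
    forall k : option 'I_n,
      [/\ derivable U p (direction k), {for p, continuous (partial k U)} &
      forall l : option 'I_n,
        derivable (partial k U) p (direction l) /\
        {for p, continuous (partial l (partial k U))}].

(* div_{x,y} (y^a grad_{x,y} U) *)
Definition weighted_divergence a U : 'rV[R]_n * R -> R :=
  fun p => \sum_(k : option 'I_n) partial k (fun q => q.2 `^ a * partial k U q) p.

(* Only the values of U on the closed half-space y >= 0 are relevant; the
   boundary condition is attained continuously. *)
Definition extension_solution a u U : Prop :=
  [/\ C2_upper_half_space U,
      forall p : 'rV[R]_n * R, 0 < p.2 -> weighted_divergence a U p = 0,
      {within [set p : 'rV[R]_n * R | 0 <= p.2], continuous U},
      forall x, U (x, 0) = u x &
      forall x, U (x, y) @[y --> +oo] --> 0].

(* Uniqueness class: pointwise decay as y -> +oo alone does not make the Dirichlet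
   problem well posed (there are nonconstant entire functions tending to 0 along
   every line, which gives harmonic counterexamples when n = 1, a = 0). *)
Definition bounded_on_half_space U : Prop :=
  exists M : R, forall x y, 0 <= y -> `|U (x, y)| <= M.

End half_space_extension.

Arguments gamma_ns {R} n s.

(* Main.v *)
(* Scaling shows that the Poisson integral is the average of u (x - y w) against
   the probability density P(w, 1), which is continuous up to y = 0 and bounded;
   for y > 0 one differentiates under the integral sign, and the equation for U
   follows from the one for the kernel.

   The weighted flux kernel y^a dP/dy is even and has zero integral for y > 0, so
   y^a dU/dy is half its integral against the second difference
   u (x + z) + u (x - z) - 2 u x = O(min (1, |z|^2)); dominated convergence as
   y -> 0 leaves the integral defining the fractional Laplacian.

   Uniqueness is a maximum principle. For two bounded solutions with the same
   trace, compare their difference on the half cube |x| <= rho, 0 <= y <= rho with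
     M ((|x|^2 - k y^2) / rho^2 + (1 + k) (y / rho)^(2 s)),  k = n / (2 - 2 s),
   a solution of the equation which is nonnegative at y = 0 and at least M on the
   remaining faces, and let rho -> oo. *)
Require Import Defs.
From mathcomp Require Import all_boot all_order all_algebra.
From mathcomp Require Import all_classical all_reals all_analysis.
From mathcomp Require Import measurable_realfun lra ring.

Import Order.TTheory GRing.Theory Num.Theory.
Import numFieldNormedType.Exports.

Local Open Scope classical_set_scope.
Local Open Scope ring_scope.

(** * Integration over tuples *)

(** All integrals over R^n rest on one closed formula, that of [(b + |t|^2) ^ (- (n/2 + s))] for
    positive [s] and [b]. It yields the mass of the Poisson kernel, the integrability of Schwartz
    functions, the domination near the origin and, taken at [s] and at [s + 1], the zero integral of
    the flux kernel. No polar coordinates occur.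

    In the comparison function the constants are forced. With a = 1 - 2 s, the operator Laplacian +
    (a / y) d_y takes |x|^2 - k y^2 to 2 n - k (4 - 4 s), whence k. It annihilates y^(2 s), whose
    coefficient 1 + k lifts the top face to M. Since s < 1, (y / rho)^2 <= (y / rho)^(2 s) on the
    half cube, so the same term outweighs - k y^2 on the lateral faces. An exact solution cannot
    contradict an interior maximum through the second derivative test, which gives only weak
    inequalities; a correction quadratic in y makes the inequality strict, and it vanishes in the
    limit of large rho. *)

Section tuple_integral.
Context {R : realType}.
Local Notation mu := (@lebesgue_measure R).
Local Notation T n := (n.-tuple (measurableTypeR R)).

Lemma measurable_tuple_cons n :
  measurable_fun setT (fun p : measurableTypeR R * T n => [tuple of p.1 :: p.2] : T n.+1).
Proof. exact: measurable_cons. Qed.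

Lemma ge0_integral_tuple_cons n (f : T n.+1 -> \bar R) :
  measurable_fun setT f -> (forall t, (0 <= f t)%E) ->
  (\int[lebesgue_tuple R n.+1]_t f t =
   \int[mu]_h \int[lebesgue_tuple R n]_t f [tuple of h :: t])%E.
Proof.
move=> mf f0.
rewrite [LHS](_ : _ = \int[pushforward (mu \x lebesgue_tuple R n)%E
   (fun p : measurableTypeR R * T n => [tuple of p.1 :: p.2] : T n.+1)]_t f t)%E//.
rewrite ge0_integral_pushforward//; last exact: measurable_tuple_cons.
rewrite preimage_setT fubini_tonelli1//.
  by apply: measurableT_comp => //; exact: measurable_tuple_cons.
by move=> x; exact: f0.
Qed.

(** The image of Lebesgue measure under [phi], multiplied by [|y|], gives every []a, b]] its length,
    and this determines Lebesgue measure. *)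
Lemma ge0_integral_affine (c y : R) (f : R -> \bar R) : y != 0 ->
  measurable_fun setT f -> (forall t, (0 <= f t)%E) ->
  (\int[mu]_t f t = `|y|%:E * \int[mu]_t f (c + y * t)%R)%E.
Proof.
move=> y0 mf f0.
pose phi (t : measurableTypeR R) : measurableTypeR R := c + y * t.
have mphi : measurable_fun setT phi.
  by apply: measurable_funD => //; apply: measurable_funM.
transitivity (`|y|%:E * \int[pushforward mu phi]_t f t)%E; last first.
  by rewrite ge0_integral_pushforward.
have ny0 : 0 <= `|y| by [].
pose M := measure_function_pushforward__canonical__measure_function_Measure mu mphi.
transitivity (\int[mscale (NngNum ny0) M]_t f t)%E; last first.
  by rewrite ge0_integral_mscale.
apply: eq_measure_integral => A mA _.
apply: lebesgue_measure_unique => // X [[a b]] _ <-.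
change (mu `]a, b] = (`|y|%:E * mu (phi @^-1` `]a, b]))%E).
have [yp|yn|] := ltgtP 0 y; last by move=> y00; rewrite -y00 eqxx in y0.
- rewrite (_ : phi @^-1` _ = `](a - c) / y, (b - c) / y]%classic); last first.
    by apply/seteqP; split => t /=; rewrite !in_itv/= ltr_pdivrMr// ler_pdivlMr// /phi mulrC; lra.
  rewrite !lebesgue_measure_itv/= !lte_fin ltr_pM2r ?invr_gt0// ltrD2r.
  case: ifPn => ab; last by rewrite mule0.
  by rewrite gtr0_norm// -EFinM; congr EFin; field; rewrite gt_eqF.
(* A negative [y] reverses the interval, so its preimage is closed on the left. *)
- rewrite (_ : phi @^-1` _ = `[(b - c) / y, (a - c) / y[%classic); last first.
    by apply/seteqP; split => t /=; rewrite !in_itv/= ltr_ndivlMr// ler_ndivrMr// /phi mulrC; lra.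
  rewrite !lebesgue_measure_itv/= !lte_fin ltr_nM2r ?invr_lt0// ltrD2r.
  case: ifPn => ab; last by rewrite mule0.
  by rewrite ltr0_norm// -EFinM; congr EFin; field; rewrite lt_eqF.
Qed.

(** Tonelli peels off the head coordinate; each coordinate contributes one factor [|y|] by the
    substitution on the line. *)
Lemma ge0_integral_tuple_affine n (c : 'I_n -> R) (y : R) (f : T n -> \bar R) :
  y != 0 -> measurable_fun setT f -> (forall t, (0 <= f t)%E) ->
  (\int[lebesgue_tuple R n]_t f t = (`|y| ^+ n)%:E *
   \int[lebesgue_tuple R n]_t f (mktuple (fun i => (c i + y * tnth t i)%R)))%E.
Proof.
move=> y0; elim: n c f => [|n IHn] c f mf f0.
  rewrite expr0 mul1e; apply: eq_integral => t _; congr f.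
  by apply: eq_from_tnth => -[].
pose aff t : T n := mktuple (fun i => c (lift ord0 i) + y * tnth t i).
have maff m (c' : 'I_m -> R) : measurable_fun setT (fun t : T m => mktuple (fun i => c' i + y * tnth t i) : T m).
  apply/measurable_fun_tnthP => i.
  rewrite [X in measurable_fun _ X](_ : _ = fun t => c' i + y * tnth t i); last first.
    by apply/funext => t /=; rewrite tnth_mktuple.
  by apply: measurable_funD => //; apply: measurable_funM => //; exact: measurable_tnth.
pose g h := (\int[lebesgue_tuple R n]_t f [tuple of h :: aff t])%E.
have mg : measurable_fun setT g.
  apply: (@measurable_fun_fubini_tonelli_F _ _ _ _ _ (lebesgue_tuple R n)
    (fun p : measurableTypeR R * T n => f [tuple of p.1 :: aff p.2])) => //.
  apply: (measurableT_comp mf); apply: measurable_cons => //.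
  exact: (measurableT_comp (maff n (fun i => c (lift ord0 i)))).
transitivity (\int[mu]_h ((`|y| ^+ n)%:E * g h))%E.
  rewrite ge0_integral_tuple_cons//; apply: eq_integral => h _.
  rewrite (IHn (fun i => c (lift ord0 i)))//.
  by apply: (measurableT_comp mf); exact: measurable_cons.
have g0 h : (0 <= g h)%E by exact: integral_ge0.
rewrite ge0_integralZl_EFin//.
rewrite (ge0_integral_affine (c ord0) y)// muleA -EFinM -exprSr; congr (_ * _)%E.
rewrite ge0_integral_tuple_cons//; last first.
  by apply: (measurableT_comp mf); exact: maff.
apply: eq_integral => h _; apply: eq_integral => t _; congr f.
apply: eq_from_tnth => i; rewrite tnth_mktuple.
case: (unliftP ord0 i) => [j ->|->]; last by rewrite !tnth0.
by rewrite !tnthS tnth_mktuple.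
Qed.

(** The Gaussian is a product over the coordinates, and each factor is the standard Gaussian
    integral rescaled by [Num.sqrt a]. *)
Lemma tuple_gauss n (a : R) : 0 < a ->
  (\int[lebesgue_tuple R n]_t (expR (- (a * \sum_i tnth t i ^+ 2)))%:E =
   ((pi / a) `^ (n%:R / 2))%:E)%E.
Proof.
move=> a0; have mf m : measurable_fun setT (fun t : T m => (expR (- (a * \sum_i tnth t i ^+ 2)))%:E).
  apply/measurable_EFinP; apply: measurableT_comp => //.
  apply: measurable_funN; apply: measurable_funM => //.
  apply: measurable_sum => i; apply: measurable_funX; exact: measurable_tnth.
have g1 : (\int[mu]_x (expR (- (a * x ^+ 2)))%:E = (Num.sqrt (pi / a))%:E)%E.
  have sa : Num.sqrt a != 0 by rewrite gt_eqF// sqrtr_gt0.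
  have := @integralT_gauss R.
  rewrite (ge0_integral_affine 0 _ _ sa)//; last 2 first.
  - by apply/measurable_EFinP; exact: measurable_gauss_fun.
  - by move=> t; rewrite lee_fin gauss_fun_ge0.
  move=> /(congr1 (fun z => (Num.sqrt a)^-1%:E * z)%E).
  rewrite muleA -EFinM -EFinM ger0_norm// mulVf// mul1e sqrtrM ?pi_ge0// sqrtrV ?(ltW a0)// mulrC => <-.
  apply: eq_integral => x _; rewrite /gauss_fun add0r exprMn sqr_sqrtr// (ltW a0)//.
have pa : 0 < pi / a by rewrite divr_gt0// pi_gt0.
elim: n => [|n IHn].
  rewrite mul0r powRr0 [LHS](_ : _ = \int[\d_ ([tuple] : T 0)]_t (expR (- (a * \sum_i tnth t i ^+ 2)))%:E)%E//.
  rewrite integral_dirac//; last by exact: mf.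
  by rewrite diracT mul1e big_ord0 mulr0 oppr0 expR0.
rewrite ge0_integral_tuple_cons//.
under eq_integral => h _.
  under eq_integral => t _.
    rewrite big_ord_recl tnth0 mulrDr opprD expRD EFinM.
    under eq_bigr do rewrite tnthS.
    over.
  rewrite ge0_integralZl_EFin//; last exact: mf.
  rewrite IHn muleC; over.
rewrite ge0_integralZl_EFin//; last 2 first.
  apply/measurable_EFinP; apply: measurableT_comp => //.
  apply: measurable_funN; apply: measurable_funM => //; exact: measurable_funX.
  by rewrite powR_ge0.
rewrite g1 -EFinM; congr EFin.
rewrite -(powR12_sqrt (ltW pa)) -powRD ?gt_eqF ?implybT//.
by congr (_ `^ _); rewrite -natr1; field.
Qed.

(** Tuples carry the product sigma-algebra, so an open set has to be exhibited as a countable union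
    of boxes: the cubes [box q] with rational centre and radius 1/(k+1) that it contains. *)
Lemma measurable_tuple_open n (O : set 'rV[R]_n) : open O ->
  measurable [set t : T n | O (\row_i tnth t i)].
Proof.
move=> oO.
pose box (q : 'rV[rat]_n * nat) : set 'rV[R]_n :=
  [set x | forall i, `|x ord0 i - ratr (q.1 ord0 i)| < q.2.+1%:R^-1].
pose F q : set (T n) := if `[< box q `<=` O >] then [set t | box q (\row_i tnth t i)] else set0.
rewrite (_ : mkset _ = \bigcup_q F q); last first.
  apply/seteqP; split => t /=; last first.
    by move=> [q _]; rewrite /F; case: ifPn => // /asboolP qO; exact: qO.
  move=> Ot; have := open_nbhs_nbhs (conj oO Ot).
  move=> /nbhs_ballP[e /= e0 eO].
  (* Half of [e], because a point of the cube is within two radii of [t], passing through the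
     rational centre. *)
  have [k k0] : exists k : nat, k.+1%:R^-1 < e / 2.
    have := near_infty_natSinv_lt (PosNum (divr_gt0 e0 (ltr0n _ 2))).
    by move=> [k _ /(_ k (leqnn k))]; exists k.
  have /choice[q hq] (i : 'I_n) : exists q, `|tnth t i - ratr q| < k.+1%:R^-1.
    have : 0 < k.+1%:R^-1 :> R by rewrite invr_gt0.
    move: (k.+1%:R^-1) => d d0.
    have h : tnth t i - d < tnth t i + d by lra.
    have [] := rat_in_itvoo h.
    by move=> q; rewrite in_itv/= => q'; exists q; rewrite ltr_norml; apply/andP; split; lra.
  exists (\row_i q i, k) => //; rewrite /F; case: ifPn => [_|].
    by move=> i; rewrite !mxE.
  move=> /asboolP; apply: contra_notP => _ x /= qx; apply: eO; split => // i j.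
  rewrite ord1 mxE /ball/=.
  have := hq j; have := qx j; rewrite mxE; move: (k.+1%:R^-1) k0 => d d0.
  rewrite !ltr_norml => /andP[? ?] /andP[? ?]; apply/andP; split; lra.
apply: countable_bigcupT_measurable => // q.
rewrite /F; case: ifP => // _.
rewrite (_ : mkset _ = \bigcap_(i in [set: 'I_n])
   [set t : T n | `|tnth t i - ratr (q.1 ord0 i)| < q.2.+1%:R^-1]); last first.
  apply/seteqP; split => t /= h i; first by move=> _; have := h i; rewrite mxE.
  by rewrite mxE; exact: h.
apply: fin_bigcap_measurable => // i _.
have : measurable_fun setT (fun t : T n => `|tnth t i - ratr (q.1 ord0 i)| : measurableTypeR R).
  apply: (measurableT_comp (@normr_measurable R setT)); apply: measurable_funB => //.
  exact: measurable_tnth.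
move=> /(_ measurableT [set x | x < q.2.+1%:R^-1]); rewrite setTI; apply.
by rewrite -set_itvNyo; exact: measurable_itv.
Qed.

Lemma measurable_tuple_continuous n (f : 'rV[R]_n -> R) : continuous f ->
  measurable_fun setT (fun t : T n => f (\row_i tnth t i)).
Proof.
move=> cf; apply: (measurability _ (RGenOpens.measurableE R)).
move=> _ [_ [a [b ->] <-]]; rewrite setTI.
apply: (@measurable_tuple_open _ (f @^-1` `]a, b[)).
by apply: open_comp => //; move=> + _; exact: cf.
Qed.

End tuple_integral.

(** * The Gamma integral *)

Section gamma_integral.
Context {R : realType}.
Local Notation mu := (@lebesgue_measure R).

Lemma powR_add (x r s : R) : 0 < x -> x `^ (r + s) = x `^ r * x `^ s.
Proof. by move=> x0; apply: powRD; apply/implyP => _; rewrite gt_eqF. Qed.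

(** The integrand may blow up at 0, so the fundamental theorem of calculus is used on
    [[1/(k+1), 1]], where the integral is at most [1 / p] for every [k]; monotone convergence
    concludes. *)
Lemma powR_integral01_lty (p : R) : 0 < p ->
  (\int[mu]_(t in `]0%R, 1%R]) (t `^ (p - 1))%:E < +oo)%E.
Proof.
move=> p0; pose F (k : nat) : set (measurableTypeR R) := `[k.+1%:R^-1, 1]%classic.
have k0 (k : nat) : 0 < k.+1%:R^-1 :> R by rewrite invr_gt0.
have UF : `]0, 1]%classic = \bigcup_k F k.
  apply/seteqP; split => t /=; rewrite ?in_itv/=.
    move=> /andP[t0 t1].
    have [k _ /(_ k (leqnn k)) kt] := near_infty_natSinv_lt (PosNum t0).
    by exists k => //; rewrite /F/= in_itv/= t1 (ltW kt).
  move=> [k _]; rewrite /F/= in_itv/= => /andP[kt ->]; rewrite andbT.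
  exact: lt_le_trans kt.
have mF k : measurable (F k) by exact: measurable_itv.
have bnd k : (\int[mu]_(t in F k) (t `^ (p - 1))%:E <= (p^-1)%:E)%E.
  have := k0 k; rewrite /F; move: (k.+1%:R^-1) => d d0.
  (* For [k = 0] the interval degenerates to the point 1. *)
  have [d1|d1] := ltP d 1; last first.
    rewrite (@integral_Sset1 _ _ _ 1) ?lee_fin ?invr_ge0 ?ltW//.
    move=> x /=; rewrite in_itv/= => /andP[dx x1]; apply/eqP; rewrite eq_le x1/=.
    exact: le_trans dx.
  have dF (x : R) : 0 < x -> is_derive x 1 (fun x => p^-1 * x `^ p) (x `^ (p - 1)).
    move=> x0; have := is_derive1_powR p x0 => h.
    by apply: is_derive_eq; rewrite /GRing.scale/=; field; rewrite gt_eqF.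
  have cF (x : R) : 0 < x -> {for x, continuous (fun x => p^-1 * x `^ p)}.
    move=> x0; apply: differentiable_continuous; apply/derivable1_diffP.
    by case: (dF _ x0).
  rewrite (@continuous_FTC2 _ _ (fun x => p^-1 * x `^ p))//.
  - rewrite -EFinB lee_fin powR1 mulr1 lerBlDr lerDl mulr_ge0 ?powR_ge0//.
    by rewrite invr_ge0 ltW.
  - apply: continuous_in_subspaceT => x /[!inE]/=; rewrite in_itv/= => /andP[dx _].
    have x0 : 0 < x by exact: lt_le_trans dx.
    have := is_derive1_powR (p - 1) x0 => -[h _].
    by apply: differentiable_continuous; apply/derivable1_diffP.
  - split.
    + move=> x; rewrite in_itv/= => /andP[dx _].
      by case: (dF _ (lt_trans d0 dx)).
    + by apply: cvg_at_right_filter; exact: cF.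
    + by apply: cvg_at_left_filter; exact: cF.
  - move=> x; rewrite in_itv/= => /andP[dx _].
    by rewrite derive1E; case: (dF _ (lt_trans d0 dx)).
apply: (@le_lt_trans _ _ (p^-1)%:E); last exact: ltry.
rewrite UF.
have mf : measurable_fun (\bigcup_k F k) (fun t : R => (t `^ (p - 1))%:E).
  by rewrite -UF; apply/measurable_EFinP/measurable_funTS; exact: measurable_powR.
have ndF : nondecreasing_seq F.
  move=> i j ij; apply/subsetPset => x /=; rewrite /F/= !in_itv/= => /andP[ix ->].
  rewrite andbT (le_trans _ ix)// lef_pV2 ?posrE ?ltr0n// ler_nat ltnS//.
have h := @ge0_nondecreasing_set_cvg_integral _ _ R F (fun t : R => (t `^ (p - 1))%:E) mu ndF mF.
have mFk k : measurable_fun (F k) (fun t : R => (t `^ (p - 1))%:E).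
  by apply/measurable_EFinP/measurable_funTS; exact: measurable_powR.
have f0 k (x : R) : F k x -> (0 <= (x `^ (p - 1))%:E)%E.
  by rewrite lee_fin powR_ge0.
have {h mFk f0}h := h mFk f0.
rewrite -(cvg_lim _ h)//.
by apply: lime_le; [exact: cvgP h|exact: nearW].
Qed.

Lemma powR_expR_integral1y_lty (q : R) :
  (\int[mu]_(t in `[1%R, +oo[) (t `^ q * expR (- t))%:E < +oo)%E.
Proof.
pose N := Num.bound `|q|.
have qN : q <= N.+1%:R.
  rewrite (le_trans (ler_norm _))// (le_trans (ltW (archi_boundP (normr_ge0 _))))//.
  by rewrite ler_nat.
(* From one term of the exponential series: [(t/2)^(N+1) / (N+1)! <= exp (t/2)]. Half of the
   exponential thus absorbs the power, and the other half is integrable. *)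
pose C : R := 2 ^+ N.+1 * N.+1`!%:R.
have bnd (t : R) : 1 <= t -> t `^ q * expR (- t) <= C * expR (- (2^-1 * t)).
  move=> t1; have t0 : 0 <= t by exact: le_trans t1.
  have h : t `^ q <= t ^+ N.+1.
    by rewrite -powR_mulrn//; apply: ler_powR.
  have h2 : (2^-1 * t) ^+ N.+1 / N.+1`!%:R <= expR (2^-1 * t).
    have t20 : 0 <= 2^-1 * t by rewrite mulr_ge0.
    by apply: le_trans (expR_ge1Dxn N t20); rewrite lerDr.
  have h3 : t ^+ N.+1 <= C * expR (2^-1 * t).
    rewrite (_ : t ^+ N.+1 = C * ((2^-1 * t) ^+ N.+1 / N.+1`!%:R)); last first.
      rewrite exprMn exprVn /C; field.
      by rewrite expf_neq0//= pnatr_eq0 -lt0n fact_gt0.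
    by rewrite ler_pM2l// /C mulr_gt0// ltr0n fact_gt0.
  rewrite (_ : - t = - (2^-1 * t) + - (2^-1 * t)); last by field.
  rewrite expRD mulrA ler_pM2r ?expR_gt0//.
  apply: le_trans (ler_wpM2r (expR_ge0 _) (le_trans h h3)) _.
  by rewrite -mulrA -expRD subrr expR0 mulr1.
have fin : (\int[mu]_(t in `[1%R, +oo[) (expR (- (2^-1 * t)))%:E < +oo)%E.
  have dF (x : R) : is_derive x 1 (fun t => - 2 * expR (- (2^-1 * t))) (expR (- (2^-1 * x))).
    apply: is_derive_eq; by rewrite /GRing.scale/=; field.
  have cF (x : R) : {for x, continuous (fun t : R => - 2 * expR (- (2^-1 * t)))}.
    by apply: differentiable_continuous; apply/derivable1_diffP; case: (dF x).
  rewrite (@ge0_continuous_FTC2y _ _ (fun t => - 2 * expR (- (2^-1 * t))) _ 0).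
  - by rewrite -EFinB ltry.
  - by move=> x _; exact: expR_ge0.
  - apply: continuous_subspaceT => x; apply: continuous_comp; last exact: continuous_expR.
    by apply: cvgN; apply: cvgMr; exact: cvg_id.
  - rewrite -[X in _ --> X](mulr0 (-2)); apply: cvgMr.
    apply: (cvg_comp (fun t : R => 2^-1 * t) (fun t => expR (- t))); last exact: cvgr_expR.
    by apply: gt0_cvgMry => //; exact: cvg_id.
  - by move=> x _; case: (dF x).
  - by apply: cvg_at_right_filter; exact: cF.
  - by move=> x _; rewrite derive1E; case: (dF x).
have C0 : 0 <= C by rewrite /C mulr_ge0// exprn_ge0.
have me : measurable_fun (`[1%R, +oo[%classic : set (measurableTypeR R)) (fun t : R => (expR (- (2^-1 * t)))%:E).
  apply/measurable_EFinP/measurable_funTS/measurableT_comp => //.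
  by apply: measurable_funN; exact: measurable_funM.
apply: (@le_lt_trans _ _ (\int[mu]_(t in `[1%R, +oo[) (C%:E * (expR (- (2^-1 * t)))%:E))%E).
  apply: ge0_le_integral => //=.
  - by move=> x _; rewrite lee_fin mulr_ge0 ?powR_ge0 ?expR_ge0.
  - apply/measurable_EFinP/measurable_funTS/measurable_funM; first exact: measurable_powR.
    by apply: measurableT_comp => //; exact: measurable_funN.
  - exact: measurable_funeM.
  - move=> x; rewrite in_itv/= andbT => x1; rewrite lee_fin; exact: bnd.
rewrite ge0_integralZl_EFin//.
by rewrite lte_mul_pinfty// lee_fin.
Qed.

Lemma Gamma_integrable (p : R) : 0 < p ->
  mu.-integrable `]0%R, +oo[ (fun t => (t `^ (p - 1) * expR (- t))%:E).
Proof.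
move=> p0; have mg : measurable_fun setT (fun t : R => (t `^ (p - 1) * expR (- t))%:E).
  apply/measurable_EFinP/measurable_funM; first exact: measurable_powR.
  by apply: measurableT_comp => //; exact: measurable_funN.
have g0 t : (0 <= (t `^ (p - 1) * expR (- t))%:E :> \bar R)%E.
  by rewrite lee_fin mulr_ge0 ?powR_ge0 ?expR_ge0.
apply/integrableP; split; first exact: measurable_funTS.
under eq_integral do rewrite gee0_abs//.
have U : `]0%R, +oo[%classic = `]0%R, 1%R] `|` (`]1%R, +oo[ : set R) :> set (measurableTypeR R).
  apply/seteqP; split => t /=; rewrite !in_itv/= !andbT.
    by case: (leP t 1) => t1 t0; [left; rewrite t0|right].
  by move=> [/andP[]//|]; apply: lt_trans.
rewrite U ge0_integral_setU//; last 2 first.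
- exact: measurable_funTS.
- rewrite disj_set2E; apply/eqP; rewrite -subset0 => x []/=; rewrite !in_itv/= andbT.
  by move=> /andP[_ x1]; rewrite ltNge x1.
rewrite lte_add_pinfty//.
- apply: le_lt_trans (powR_integral01_lty _ p0); apply: ge0_le_integral => //.
  + exact: measurable_funTS.
  + by apply/measurable_EFinP/measurable_funTS; exact: measurable_powR.
  + move=> x /=; rewrite in_itv/= => /andP[x0 _]; rewrite lee_fin ler_piMr ?powR_ge0//.
    by rewrite -expR0 ler_expR oppr_le0 ltW.
- apply: le_lt_trans (powR_expR_integral1y_lty (p - 1)); apply: ge0_subset_integral => //.
  + exact: measurable_funTS.
  + by move=> x /=; rewrite !in_itv/= !andbT => /ltW.
Qed.

Lemma Gamma_integralE (p : R) : 0 < p ->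
  (\int[mu]_(t in `]0%R, +oo[) (t `^ (p - 1) * expR (- t))%:E = (Gamma p)%:E)%E.
Proof.
move=> p0; rewrite /Gamma /Rintegral fineK//.
exact: (integrable_fin_num _ (Gamma_integrable _ p0)).
Qed.

(** A zero integral would make the integrand vanish almost everywhere, but it is positive on a
    half-line of infinite measure. *)
Lemma Gamma_gt0 (p : R) : 0 < p -> 0 < Gamma p.
Proof.
move=> p0; rewrite -lte_fin -Gamma_integralE// lt0e; apply/andP; split; last first.
  by apply: integral_ge0 => t _; rewrite lee_fin mulr_ge0 ?powR_ge0 ?expR_ge0.
apply/eqP => h.
have g0 t : (0 <= (t `^ (p - 1) * expR (- t))%:E :> \bar R)%E.
  by rewrite lee_fin mulr_ge0 ?powR_ge0 ?expR_ge0.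
have : ae_eq mu (`]0%R, +oo[%classic : set (measurableTypeR R)) (fun t : R => (t `^ (p - 1) * expR (- t))%:E) (cst 0%E).
  apply/(ae_eq_integral_abs mu) => //; first by have /integrableP[] := Gamma_integrable _ p0.
  by under eq_integral do rewrite gee0_abs//.
case=> A [mA A0 sA].
have : (mu `]0%R, +oo[ <= mu A)%E.
  rewrite le_measure ?inE// => t; rewrite /= in_itv/= andbT => t0; apply: sA => /=.
  rewrite in_itv/= t0 => /(_ erefl) [] /eqP; apply/negP.
  by rewrite mulf_eq0 negb_or !gt_eqF ?powR_gt0 ?expR_gt0.
by rewrite [X in (_ <= X)%E]A0 lebesgue_measure_itv/= ltry.
Qed.

(** The substitution of [r * t] for [t] in the Gamma integral. Read from right to left, it writes a
    negative power of [r] as a superposition of exponentials. *)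
Lemma powR_expR_integral (p r : R) : 0 < p -> 0 < r ->
  (\int[mu]_(t in `]0%R, +oo[) (t `^ (p - 1) * expR (- (t * r)))%:E = (Gamma p / r `^ p)%:E)%E.
Proof.
move=> p0 r0;
have mg : measurable_fun setT ((fun t : R => (t `^ (p - 1) * expR (- t))%:E) \_ `]0%R, +oo[).
  apply: (measurable_restrictT _ _).1 => //; apply/measurable_EFinP/measurable_funTS.
  apply: measurable_funM; first exact: measurable_powR.
  by apply: measurableT_comp => //; exact: measurable_funN.
have g0 t : (0 <= ((fun t : R => (t `^ (p - 1) * expR (- t))%:E) \_ `]0%R, +oo[) t :> \bar R)%E.
  by apply: erestrict_ge0 => x _; rewrite lee_fin mulr_ge0 ?powR_ge0 ?expR_ge0.
rewrite EFinM -Gamma_integralE//.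
rewrite [in RHS]integral_mkcond (ge0_integral_affine 0 r)//; last by rewrite gt_eqF.
transitivity (`|r|%:E * ((r `^ (p - 1))%:E *
    \int[mu]_(t in `]0%R, +oo[) (t `^ (p - 1) * expR (- (t * r)))%:E) * ((r `^ p)^-1)%:E)%E.
  rewrite muleCA muleA -EFinM muleC muleA -EFinM ger0_norm ?(ltW r0)//.
  by rewrite (mulrC _ r) mulr_powRB1 ?(ltW r0)// mulVf ?mul1e// gt_eqF// powR_gt0.
congr (_ * _ * _)%E.
rewrite -ge0_integralZl_EFin ?powR_ge0//; last 2 first.
- by move=> x _; rewrite lee_fin mulr_ge0 ?powR_ge0 ?expR_ge0.
- apply/measurable_EFinP/measurable_funTS.
  apply: measurable_funM; first exact: measurable_powR.
  by apply: measurableT_comp => //; apply: measurable_funN => //; exact: measurable_funM.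
rewrite integral_mkcond; apply: eq_integral => x _; rewrite add0r /patch.
rewrite !mem_setE !in_itv/= !andbT pmulr_rgt0//; case: ifPn => // x0.
rewrite -EFinM powRM ?(ltW r0) ?(ltW x0)// mulrA (mulrC r x).
by congr ((_ * _)%:E).
Qed.

End gamma_integral.

(** * Power integrals over R^n *)

Section euclid.
Context {R : realType} {n : nat}.
Local Notation mu := (@lebesgue_measure R).
Local Notation T := (n.-tuple (measurableTypeR R)).

Definition normsq (x : 'rV[R]_n) : R := \sum_i x ord0 i ^+ 2.

Lemma normsq_ge0 x : 0 <= normsq x.
Proof. by apply: sumr_ge0 => i _; exact: sqr_ge0. Qed.

Lemma enorm_sqr x : enorm x ^+ 2 = normsq x.
Proof. by rewrite sqr_sqrtr// normsq_ge0. Qed.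

Lemma enorm_powR x (p : R) : enorm x `^ (2 * p) = normsq x `^ p.
Proof. by rewrite powRrM -enorm_sqr powR_mulrn// sqrtr_ge0. Qed.

Lemma normsq_row (t : T) : normsq (\row_i tnth t i) = \sum_i tnth t i ^+ 2.
Proof. by apply: eq_bigr => i _; rewrite mxE. Qed.

Lemma continuous_normsq : continuous (normsq : 'rV[R]_n -> R^o).
Proof.
move=> x; apply: (@cvg_big _ _ _ _ _ _ _ _ _ (fun i (x : 'rV[R]_n) => x ord0 i ^+ 2)).
- exact: add_continuous.
- exact: nbhs_filter.
- move=> i _.
  have : {for x, continuous (fun x : 'rV[R]_n => x ord0 i ^+ 2)}.
    by apply: (@continuous_comp _ _ _ (fun x1 : 'rV[R]_n => x1 ord0 i) (fun y : R => y ^+ 2) x);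
      [exact: coord_continuous|exact: exprn_continuous].
  exact.
Qed.

Lemma measurable_normsq :
  measurable_fun setT (fun t : T => normsq (\row_i tnth t i)).
Proof. by apply: measurable_tuple_continuous; exact: continuous_normsq. Qed.

(* Write (b + |t|^2)^(- m) as a Gamma integral in an auxiliary variable and apply
   Tonelli: the inner integral is Gaussian. *)
Lemma bessel_integral (s b : R) : 0 < s -> 0 < b ->
  (\int[lebesgue_tuple R n]_t ((b + normsq (\row_i tnth t i)) `^ (- (n%:R / 2 + s)))%:E =
   (pi `^ (n%:R / 2) * Gamma s / Gamma (n%:R / 2 + s) * b `^ (- s))%:E)%E.
Proof.
move=> s0 b0; set m := n%:R / 2 + s.
have m0 : 0 < m by rewrite ltr_wpDl// divr_ge0.
pose f (p : T * measurableTypeR R) : R :=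
  p.2 `^ (m - 1) * expR (- (p.2 * (b + normsq (\row_i tnth p.1 i)))).
pose F := (fun p : T * measurableTypeR R => (f p)%:E) \_ (setT `*` `]0%R, +oo[%classic).
have mf : measurable_fun setT f.
  apply: measurable_funM.
    by apply: (measurableT_comp (measurable_powR _)).
  apply: measurableT_comp => //; apply: measurable_funN; apply: measurable_funM => //.
  by apply: measurable_funD => //; apply: (measurableT_comp measurable_normsq).
have mF : measurable_fun setT F.
  apply: (measurable_restrictT _ _).1; first by apply: measurableX.
  by apply/measurable_EFinP/measurable_funTS.
have F0 p : (0 <= F p)%E.
  by apply: erestrict_ge0 => q _; rewrite lee_fin mulr_ge0 ?powR_ge0 ?expR_ge0.
have := @fubini_tonelli _ _ _ _ _ (lebesgue_tuple R n) mu F mF F0.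
have FE t r : F (t, r) = ((fun r : measurableTypeR R => (f (t, r))%:E) \_ `]0%R, +oo[) r.
  rewrite /F /patch; congr (if _ then _ else _).
  by apply/idP/idP => /[!inE] => [[]|].
under eq_integral => t _.
  under eq_integral => r _ do rewrite FE.
  rewrite -integral_mkcond /f/= powR_expR_integral//; last first.
    by rewrite ltr_wpDr// normsq_ge0.
  rewrite EFinM -powRN; over.
rewrite ge0_integralZl_EFin//; last 3 first.
- by move=> t _; rewrite lee_fin powR_ge0.
- apply/measurable_EFinP; apply: (measurableT_comp (measurable_powR _)).
  by apply: measurable_funD => //; exact: measurable_normsq.
- by rewrite ltW// Gamma_gt0.
under [in X in _ = X -> _]eq_integral => r _.
  under eq_integral => t _ do rewrite FE.
  over.
set X := (\int[_]_x _)%E => h.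
have {}h : ((Gamma m)%:E * X = (pi `^ (n%:R / 2) * (Gamma s / b `^ s))%:E)%E.
  rewrite h EFinM -powR_expR_integral// -ge0_integralZl_EFin ?powR_ge0//; last 2 first.
  - by move=> r _; rewrite lee_fin mulr_ge0 ?powR_ge0 ?expR_ge0.
  - apply/measurable_EFinP/measurable_funTS.
    apply: measurable_funM; first exact: measurable_powR.
    by apply: measurableT_comp => //; apply: measurable_funN => //; exact: measurable_funM.
  rewrite [in RHS]integral_mkcond; apply: eq_integral => r _; rewrite /patch.
  case: ifPn => r0; last by rewrite integral0.
  have {}r0 : 0 < r by move: r0; rewrite mem_setE in_itv/= andbT.
  transitivity (\int[lebesgue_tuple R n]_t ((r `^ (m - 1) * expR (- (r * b)))%:E *
     (expR (- (r * \sum_i tnth t i ^+ 2)))%:E))%E.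
    apply: eq_integral => t _.
    by rewrite -EFinM /f/= mulrDr opprD expRD normsq_row mulrA.
  rewrite ge0_integralZl_EFin//; last 2 first.
  - apply/measurable_EFinP; apply: measurableT_comp => //.
    apply: measurable_funN; apply: measurable_funM => //.
    apply: measurable_sum => i; apply: measurable_funX; exact: measurable_tnth.
  - by rewrite mulr_ge0 ?powR_ge0 ?expR_ge0.
  rewrite tuple_gauss// -!EFinM; congr EFin.
  rewrite powRM ?pi_ge0 ?invr_ge0 ?(ltW r0)// -(powR_inv1 (ltW r0)) -powRrM.
  (* The factor [r ^ (- n/2)] of the Gaussian integral lowers the exponent [m - 1] to [s - 1], which
     leaves a Gamma integral of parameter [s]. *)
  rewrite (_ : m - 1 = (s - 1) + n%:R / 2); last by rewrite /m; ring.
  rewrite mulN1r powR_add//.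
  rewrite powRN; field; rewrite gt_eqF// powR_gt0//.
have G0 := Gamma_gt0 _ m0.
have : ((Gamma m)^-1%:E * ((Gamma m)%:E * X) = (Gamma m)^-1%:E * (pi `^ (n%:R / 2) * (Gamma s / b `^ s))%:E)%E.
  by rewrite h.
rewrite muleA -EFinM mulVf ?gt_eqF// mul1e => ->.
by rewrite -EFinM powRN; congr EFin; ring.
Qed.

Lemma measurable_bessel (b p : R) :
  measurable_fun setT (fun t : T => ((b + normsq (\row_i tnth t i)) `^ p)).
Proof.
apply: (measurableT_comp (measurable_powR _)).
by apply: measurable_funD => //; exact: measurable_normsq.
Qed.

Lemma bessel_integrable (s b : R) : 0 < s -> 0 < b ->
  (lebesgue_tuple R n).-integrable setT
    (fun t => ((b + normsq (\row_i tnth t i)) `^ (- (n%:R / 2 + s)))%:E).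
Proof.
move=> s0 b0; apply/integrableP; split.
  by apply/measurable_EFinP; exact: measurable_bessel.
under eq_integral do rewrite gee0_abs ?lee_fin ?powR_ge0//.
by rewrite bessel_integral// ltry.
Qed.

(* The mass near the origin is controlled by integrating [bessel_integral] with
   b = y^2 against y dy on ]0, 1]. *)
Lemma riesz_integrable (s : R) : 0 < s -> s < 1 ->
  (lebesgue_tuple R n).-integrable setT
    (fun t => (Num.min 1 (normsq (\row_i tnth t i)) / normsq (\row_i tnth t i) `^ (n%:R / 2 + s))%:E).
Proof.
move=> s0 s1; set m := n%:R / 2 + s.
have m0 : 0 < m by rewrite ltr_wpDl// divr_ge0.
pose q (t : T) := normsq (\row_i tnth t i).
pose f (p : T * measurableTypeR R) : R := p.2 * (p.2 ^+ 2 + q p.1) `^ (- m).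
pose F := (fun p : T * measurableTypeR R => (f p)%:E) \_ (setT `*` `]0%R, 1%R]%classic).
pose G t := (\int[mu]_(y in `]0%R, 1%R]) (f (t, y))%:E)%E.
have mf : measurable_fun setT f.
  apply: measurable_funM => //.
  apply: (measurableT_comp (measurable_powR _)).
  by apply: measurable_funD; [exact: measurable_funX|apply: (measurableT_comp measurable_normsq)].
have mF : measurable_fun setT F.
  apply: (measurable_restrictT _ _).1; first by apply: measurableX.
  by apply/measurable_EFinP/measurable_funTS.
have F0 p : (0 <= F p)%E.
  apply: erestrict_ge0 => -[t y] /= [_]; rewrite in_itv/= => /andP[y0 _].
  by rewrite lee_fin mulr_ge0 ?powR_ge0 ?(ltW y0).
have FE t r : F (t, r) = ((fun r : measurableTypeR R => (f (t, r))%:E) \_ `]0%R, 1%R]) r.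
  rewrite /F /patch; congr (if _ then _ else _).
  by apply/idP/idP => /[!inE] => [[]|].
have GE t : (G t = \int[mu]_y F (t, y))%E.
  by rewrite /G integral_mkcond; apply: eq_integral => y _; rewrite FE.
have mG : measurable_fun setT G.
  rewrite (_ : G = fun t => \int[mu]_y F (t, y))%E; last exact/funext.
  exact: (@measurable_fun_fubini_tonelli_F _ _ _ _ _ mu).
have G0 t : (0 <= G t)%E by rewrite GE; exact: integral_ge0.
have Gfin : (\int[lebesgue_tuple R n]_t G t < +oo)%E.
  under eq_integral do rewrite GE.
  rewrite (@fubini_tonelli _ _ _ _ _ (lebesgue_tuple R n) mu F mF F0).
  set C := pi `^ (n%:R / 2) * Gamma s / Gamma m.
  have C0 : 0 <= C by rewrite /C !mulr_ge0 ?powR_ge0// ?invr_ge0 ltW// Gamma_gt0.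
  (* Integrating over R^n first leaves [C * y ^ (1 - 2 s)], integrable at 0 because [s < 1]. *)
  rewrite (_ : (\int[mu]_y _)%E = (\int[mu]_(y in `]0%R, 1%R]) (C%:E * (y `^ ((2 - 2 * s) - 1))%:E))%E).
    rewrite ge0_integralZl_EFin//; last 2 first.
    - by move=> r _; rewrite lee_fin powR_ge0.
    - by apply/measurable_EFinP/measurable_funTS; exact: measurable_powR.
    by rewrite lte_mul_pinfty// ?lee_fin// powR_integral01_lty//; lra.
  rewrite [in RHS]integral_mkcond; apply: eq_integral => y _.
  under eq_integral do rewrite FE /patch.
  rewrite /patch; case: ifPn => y0; last by rewrite integral0.
  have {}y0 : 0 < y by move: y0; rewrite mem_setE in_itv/= => /andP[].
  rewrite /f/=; under eq_integral do rewrite EFinM.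
  rewrite ge0_integralZl_EFin ?(ltW y0)//; last 2 first.
  - by move=> r _; rewrite lee_fin powR_ge0.
  - by apply/measurable_EFinP; exact: measurable_bessel.
  rewrite bessel_integral// ?exprn_gt0// -EFinM; congr EFin.
  rewrite mulrCA; congr (_ * _).
  rewrite -powR_mulrn ?(ltW y0)// -powRrM.
  rewrite (_ : 2 - 2 * s - 1 = 1 + 2%:R * - s); last by ring.
  by rewrite powR_add ?powRr1 ?(ltW y0).
have q0 t : 0 <= q t by exact: normsq_ge0.
(* Where [q >= 1], the inequality [1 + q <= 2 q] gives the second term. Where [0 < q < 1], put
   [e = sqrt q]: the part of [G] over [[e/2, e]] is at least [(e/2)^2 (2 q)^(- m) = 2^(- m - 2) q^(1
   - m)], which explains the constant [2 ^ (m + 2)]. *)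
have key t : ((Num.min 1 (q t) / q t `^ m)%:E <=
    (2 `^ (m + 2))%:E * G t + (2 `^ m * (1 + q t) `^ (- m))%:E)%E.
  have [q1|q1] := leP 1 (q t).
    apply: lee_paddl; first by rewrite mule_ge0// lee_fin powR_ge0.
    have h : (1 + q t) `^ m <= 2 `^ m * q t `^ m.
      rewrite -powRM//; apply: ge0_ler_powR; rewrite ?nnegrE ?(ltW m0)//; lra.
    have A0 : 0 < q t `^ m by apply: powR_gt0; lra.
    have B0 : 0 < (1 + q t) `^ m by apply: powR_gt0; lra.
    by rewrite lee_fin powRN mul1r ler_pdivlMr// mulrC ler_pdivrMr.
  have [q2|q2] := leP (q t) 0.
    have -> : q t = 0 by apply/eqP; rewrite eq_le q2 q0.
    by rewrite mul0r adde_ge0// ?mule_ge0 ?lee_fin ?mulr_ge0 ?powR_ge0.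
  apply: lee_paddr; first by rewrite lee_fin mulr_ge0 ?powR_ge0.
  set e := Num.sqrt (q t).
  have e0 : 0 < e by rewrite sqrtr_gt0.
  have eq : q t = e ^+ 2 by rewrite sqr_sqrtr// ltW.
  have e1 : e <= 1 by rewrite -sqrtr1 ler_sqrt// ltW.
  have e2 : e / 2 < e by lra.
  pose k := (e / 2) * (2 * q t) `^ (- m).
  have : (k%:E * (e / 2)%:E <= G t)%E.
    apply: (@le_trans _ _ (\int[mu]_(y in `[(e / 2)%R, e]) (f (t, y))%:E)%E); last first.
      apply: ge0_subset_integral => //.
      + apply/measurable_EFinP/measurable_funTS.
        exact: (measurable_fun_pair2 _ mf).
      + move=> y /=; rewrite in_itv/= => /andP[y0 _].
        by rewrite lee_fin mulr_ge0 ?powR_ge0 ?(ltW y0).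
      + move=> y /=; rewrite !in_itv/= => /andP[ey ye].
        by apply/andP; split; [lra|exact: le_trans e1].
    have -> : (e / 2)%:E = mu `[(e / 2)%R, e].
      rewrite lebesgue_measure_itv/= lte_fin e2 -EFinB; congr EFin; lra.
    rewrite -integral_cst//; apply: ge0_le_integral => //.
    + by move=> y _; rewrite lee_fin /k mulr_ge0 ?powR_ge0//; lra.
    + apply/measurable_EFinP/measurable_funTS.
      exact: (measurable_fun_pair2 _ mf).
    + move=> y /=; rewrite !in_itv/= => /andP[ey ye]; rewrite lee_fin /k /f/=.
      apply: ler_pM => //; [lra|exact: powR_ge0|].
      rewrite !powRN lef_pV2 ?posrE ?powR_gt0//; last 2 first.
      * by rewrite mulr_gt0.
      * by rewrite ltr_wpDl// sqr_ge0.
      apply: ge0_ler_powR; rewrite ?nnegrE; [lra|..].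
      * by rewrite addr_ge0// sqr_ge0.
      * lra.
      * by rewrite eq mulrDl mul1r lerD2r lerXn2r ?nnegrE; lra.
  have p2 : (0 <= (2 `^ (m + 2))%:E :> \bar R)%E by rewrite lee_fin powR_ge0.
  move=> /(lee_wpmul2l p2); apply: le_trans.
  rewrite -!EFinM lee_fin /k powRM// ?(ltW q2)// powRN.
  have h4 : 2 `^ 2 = 4 :> R by rewrite (@powR_mulrn _ _ 2)// expr2; ring.
  rewrite (powR_add 2 m 2)// h4 !powRN le_eqVlt; apply/orP; left; apply/eqP.
  rewrite {1}eq; field.
  by rewrite !gt_eqF ?powR_gt0.
apply: (@le_integrable _ _ _ _ _ measurableT _ (fun t => (2 `^ (m + 2))%:E * G t + (2 `^ m)%:E * ((1 + q t) `^ (- m))%:E)%E).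
- apply/measurable_EFinP; apply: measurable_funM.
    by apply: measurable_minr => //; exact: measurable_normsq.
  rewrite (_ : (fun t => _) = (fun t => (0 + normsq (\row_i tnth t i)) `^ (- m))); last first.
    by apply/funext => t; rewrite add0r powRN.
  exact: measurable_bessel.
- move=> t _; rewrite gee0_abs; last by rewrite lee_fin divr_ge0 ?powR_ge0// le_min q0 ler01.
  apply: le_trans (key t) _; rewrite EFinM; exact: lee_abs.
- apply: integrableD => //; apply: integrableZl => //; last exact: bessel_integrable.
  apply/integrableP; split => //.
  by under eq_integral do rewrite gee0_abs//.
Qed.

End euclid.

Set Implicit Arguments.
Unset Strict Implicit.

(** * Differentiation under the convolution integral *)

Section parameter_integral.
Context {R : realType}.

(** Dominated convergence concerns sequences; this criterion carries it over to limits along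
    [nbhs p]. *)
Lemma cvg_nbhs_seq (V : normedModType R) (f : V -> R) (p : V) (l : R) :
  (forall w : nat -> V, w n @[n --> \oo] --> p -> f (w n) @[n --> \oo] --> l) ->
  f x @[x --> p] --> l.
Proof.
move=> H; apply/cvgrPdist_lt => e e0; apply: contrapT => h.
have /choice[w hw] (k : nat) : exists q, `|p - q| < k.+1%:R^-1 /\ e <= `|l - f q|.
  apply: contrapT => /forallNP Hq; apply: h; near=> q.
  have : `|p - q| < k.+1%:R^-1.
    by near: q; apply: (@cvgr_dist_lt R V V (nbhs p) _ id p); rewrite ?invr_gt0//; exact: cvg_id.
  by move=> pq; have /not_andP[//|/negP] := Hq q; rewrite -ltNge.
have wp : w n @[n --> \oo] --> p.
  apply/cvgrPdist_lt => d d0; near=> k; apply: lt_trans (hw k).1 _.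
  by near: k; exact: (near_infty_natSinv_lt (PosNum d0)).
have /cvgrPdist_lt/(_ _ e0)[N _ HN] := H w wp.
by have := HN N (leqnn N); rewrite ltNge (hw N).2.
Unshelve. all: by end_near. Qed.

Lemma continuous_param_Rintegral (V : normedModType R) d (Y : measurableType d)
    (mu : {measure set Y -> \bar R}) (F : V -> Y -> R) (p : V) (g : Y -> R) :
  mu.-integrable setT (EFin \o g) ->
  (\forall q \near p, measurable_fun setT (F q)) ->
  (\forall q \near p, forall t, `|F q t| <= g t) ->
  (forall t, {for p, continuous (F ^~ t)}) ->
  {for p, continuous (fun q => \int[mu]_t F q t)}.
Proof.
move=> ig mF bF cF; apply: cvg_nbhs_seq => w wp.
(* Measurability and domination are given only near [p], hence only from some index on; the sequence
   is shifted by that index. *)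
have [N _ HN] : \forall n \near \oo, measurable_fun setT (F (w n)) /\ forall t, `|F (w n) t| <= g t.
  by near=> n; split; near: n; [exact: (wp _ mF)|exact: (wp _ bF)].
rewrite -(cvg_shiftn N).
have mw n : measurable_fun setT (F (w (n + N)%N)).
  by apply: (HN _ _).1; exact: leq_addl.
have bw n t : `|F (w (n + N)%N) t| <= g t.
  by apply: (HN _ _).2; exact: leq_addl.
have Fw t : (F (w (n + N)%N) t)%:E @[n --> \oo] --> (F p t)%:E.
  apply: cvg_EFin; first exact: nearW.
  by rewrite (cvg_shiftn N (fun n => F (w n) t)); exact: (cvg_comp (fun n => w n) (fun q => F q t) wp (cF t)).
have mp : measurable_fun setT (EFin \o F p).
  apply: (emeasurable_fun_cvg (fun n t => (F (w (n + N)%N) t)%:E)) => [n|t _].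
    exact/measurable_EFinP.
  exact: Fw.
have mw' n : measurable_fun setT (fun t => (F (w (n + N)%N) t)%:E) by exact/measurable_EFinP.
have bw' : {ae mu, forall t n, setT t -> (`|(F (w (n + N)%N) t)%:E| <= (EFin \o g) t)%E}.
  by apply: aeW => t n _; rewrite lee_fin.
have [ip _] := dominated_convergence measurableT mw' mp (aeW _ (fun t _ => Fw t)) ig bw'.
move=> h; suff : (\int[mu]_x (F (w (n + N)%N) x)%:E)%E @[n --> \oo] --> ((\int[mu]_x F p x)%R)%:E.
  exact: fine_cvg.
rewrite /Rintegral fineK//; exact: integrable_fin_num.
Unshelve. all: by end_near. Qed.

(** Reduces directional derivatives to calculus in one variable: the two difference quotients are
    the same function. *)
Lemma is_derive_line (V : normedModType R) (K : V -> R) (p v : V) (l : R) :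
  is_derive (0 : R) 1 (fun h => K (h *: v + p)) l -> is_derive p v K l.
Proof.
have E : (fun h : R => h^-1 *: ((K \o shift p) (h *: v) - K p)) =
    (fun h => h^-1 *: (((fun h => K (h *: v + p)) \o shift 0) h%:A - K (0 *: v + p))).
  by apply/funext => h /=; rewrite addr0 scale0r add0r [h%:A]mulr1.
by move=> [dK <-]; split; rewrite /derivable /derive E.
Qed.

Lemma is_derive_lineV (V : normedModType R) (K : V -> R) (p v : V) (h l : R) :
  is_derive (h *: v + p) v K l -> is_derive h 1 (fun h => K (h *: v + p)) l.
Proof.
move=> [dK <-].
have E : (fun t : R => t^-1 *: (((fun h => K (h *: v + p)) \o shift h) t%:A - K (h *: v + p))) =
  (fun t => t^-1 *: ((K \o shift (h *: v + p)) (t *: v) - K (h *: v + p))).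
  by apply/funext => t /=; rewrite [t%:A]mulr1 scalerDl addrA.
by split; rewrite /derivable /derive E.
Qed.

End parameter_integral.

(** * Kernels that may be differentiated under a convolution *)

Section good_kernels.
Context {R : realType} {n : nat}.
Local Notation V := ('rV[R]_n * R)%type.
Implicit Types (K L : V -> R) (p q : V).

(* [good k K]: on y > 0 the partial derivatives of K up to order k exist, are
   continuous and are bounded on every strip d <= y <= 1/d, so that K may be
   differentiated k times under a convolution with an integrable function. *)
Definition bounded_on_strips K := forall d : R, 0 < d ->
  exists M : R, forall p, d <= p.2 -> p.2 <= d^-1 -> `|K p| <= M.

Definition good0 K :=
  (forall p, 0 < p.2 -> {for p, continuous K}) /\ bounded_on_strips K.

Fixpoint good (k : nat) K : Prop :=
  good0 K /\ (if k is k'.+1 then forall d : option 'I_n,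
    (forall p, 0 < p.2 -> derivable K p (direction d)) /\ good k' (partial d K)
  else True).

Lemma continuous_at_pair (W : topologicalType) (f : W -> 'rV[R]_n) (g : W -> R) (w : W) :
  {for w, continuous f} -> {for w, continuous g} ->
  {for w, continuous (fun x => (f x, g x) : V)}.
Proof.
move=> cf cg A [[B C] /= [fB gC] BC].
have := cf _ fB; have := cg _ gC; rewrite /= /nbhs/= => h1 h2.
by apply: filterS2 h1 h2 => x Cx Bx; exact: BC.
Qed.

Lemma near_half_space p : 0 < p.2 -> \forall q \near p, 0 < q.2.
Proof. by move=> p0; apply: (@cvgr_gt R V (nbhs p) _ snd p.2) => //; exact: cvg_snd. Qed.

Lemma partial_ext K L p (d : option 'I_n) : (forall q, 0 < q.2 -> K q = L q) -> 0 < p.2 ->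
  partial d K p = partial d L p.
Proof.
move=> KL p0; apply: near_eq_derive; near=> q; apply: KL; near: q; exact: near_half_space.
Unshelve. all: by end_near. Qed.

Lemma derivable_ext K L p (d : option 'I_n) : (forall q, 0 < q.2 -> K q = L q) -> 0 < p.2 ->
  derivable K p (direction d) -> derivable L p (direction d).
Proof.
move=> KL p0; apply: near_eq_derivable; near=> q; apply: KL; near: q; exact: near_half_space.
Unshelve. all: by end_near. Qed.

Lemma continuous_ext K L p : (forall q, 0 < q.2 -> K q = L q) -> 0 < p.2 ->
  {for p, continuous K} -> {for p, continuous L}.
Proof.
move=> KL p0; rewrite /prop_for /continuous_at -KL//; apply: cvg_trans.
apply: near_eq_cvg; near=> q; apply: KL; near: q; exact: near_half_space.
Unshelve. all: by end_near. Qed.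

Lemma good_ext k K L : (forall q, 0 < q.2 -> K q = L q) -> good k K -> good k L.
Proof.
have good0_ext K' L' : (forall q, 0 < q.2 -> K' q = L' q) -> good0 K' -> good0 L'.
  move=> KL [cK bK]; split.
    by move=> p p0; exact: (continuous_ext KL p0 (cK _ p0)).
  move=> d d0; have [M HM] := bK d d0; exists M => p dp pd.
  by rewrite -KL ?HM// (lt_le_trans d0).
elim: k K L => [|k IHk] K L KL [gK dK]; split => //; try exact: good0_ext gK.
move=> d; split; first by move=> p p0; exact: (derivable_ext KL p0 ((dK d).1 _ p0)).
apply: (IHk (partial d K)); last exact: (dK d).2.
by move=> q q0; exact: partial_ext.
Qed.

Lemma goodW k K : good k.+1 K -> good k K.
Proof.
elim: k K => [|k IHk] K [gK dK]; split => // d; split; first exact: (dK d).1.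
by apply: IHk; exact: (dK d).2.
Qed.

Lemma good_cst k (c : R) : good k (cst c).
Proof.
elim: k c => [|k IHk] c; split => //; try by split;
  [move=> p _; exact: cst_continuous|move=> d _; exists `|c|].
move=> d; split; first by move=> p _; exact: derivable_cst.
apply: (@good_ext _ (cst 0)); last exact: IHk.
by move=> q _; rewrite /partial derive_cst.
Qed.

Lemma good0D K L : good0 K -> good0 L -> good0 (K \+ L).
Proof.
move=> [cK bK] [cL bL]; split.
  by move=> p p0; apply: cvgD; [exact: cK|exact: cL].
move=> d d0; have [M1 H1] := bK d d0; have [M2 H2] := bL d d0; exists (M1 + M2) => p dp pd.
by rewrite (le_trans (ler_normD _ _))// lerD ?H1 ?H2.
Qed.

Lemma good0M K L : good0 K -> good0 L -> good0 (K \* L).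
Proof.
move=> [cK bK] [cL bL]; split.
  by move=> p p0; apply: cvgM; [exact: cK|exact: cL].
move=> d d0; have [M1 H1] := bK d d0; have [M2 H2] := bL d d0; exists (M1 * M2) => p dp pd.
by rewrite normrM ler_pM ?H1 ?H2.
Qed.

Lemma goodD k K L : good k K -> good k L -> good k (K \+ L).
Proof.
elim: k K L => [|k IHk] K L [gK dK] [gL dL]; split => //; try exact: good0D.
move=> d; have [dK1 dK2] := dK d; have [dL1 dL2] := dL d; split.
  by move=> p p0; apply: derivableD; [exact: dK1|exact: dL1].
apply: (@good_ext _ (partial d K \+ partial d L)); last exact: IHk.
by move=> q q0; rewrite /partial deriveD//; [exact: dK1|exact: dL1].
Qed.

Lemma goodM k K L : good k K -> good k L -> good k (K \* L).
Proof.
elim: k K L => [|k IHk] K L gK gL.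
  by case: gK gL => [gK _] [gL _]; split => //; exact: good0M.
have gK' := goodW gK; have gL' := goodW gL.
case: gK gL => [gK dK] [gL dL]; split; first exact: good0M.
move=> d; have [dK1 dK2] := dK d; have [dL1 dL2] := dL d; split.
  by move=> p p0; apply: derivableM; [exact: dK1|exact: dL1].
apply: (@good_ext _ ((K \* partial d L) \+ (L \* partial d K))).
  by move=> q q0; rewrite /partial deriveM//; [exact: dK1|exact: dL1].
by apply: goodD; exact: IHk.
Qed.

(** The coordinates x_i and y as one family indexed like [direction], so that derivatives and sums
    treat them uniformly. *)
Definition hcoord (k : option 'I_n) p : R := if k is Some i then p.1 ord0 i else p.2.

Definition rr p : R := p.2 ^+ 2 + normsq p.1.

Lemma rrE p : rr p = \sum_k hcoord k p ^+ 2.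
Proof.
rewrite (bigD1 None)//= /rr; congr (_ + _).
rewrite (reindex_omap (Some : 'I_n -> _) id)/=; last by case.
by apply: eq_bigl => i; rewrite eqxx.
Qed.

Lemma rr_gt0 p : 0 < p.2 -> 0 < rr p.
Proof. by move=> p0; rewrite ltr_wpDr ?normsq_ge0// exprn_gt0. Qed.

Lemma hcoord_direction k l : hcoord k (direction l : V) = (k == l)%:R.
Proof.
by case: k l => [i|] [j|] //=; rewrite mxE// eqxx/= eq_sym; congr (nat_of_bool _)%:R; apply/eqP/eqP => [->//|[->]].
Qed.

Lemma hcoordD k p q : hcoord k (p + q) = hcoord k p + hcoord k q.
Proof. by case: k => [i|] //=; rewrite mxE. Qed.

Lemma hcoordZ k (h : R) p : hcoord k (h *: p) = h * hcoord k p.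
Proof. by case: k => [i|] //=; rewrite mxE. Qed.

Lemma rr_line p l (h : R) : rr (h *: direction l + p) = rr p + 2 * hcoord l p * h + h ^+ 2.
Proof.
rewrite !rrE (bigD1 l)//= [in RHS](bigD1 l)//= hcoordD hcoordZ hcoord_direction eqxx.
rewrite (eq_bigr (fun k => hcoord k p ^+ 2)); last first.
  by move=> k kl; rewrite hcoordD hcoordZ hcoord_direction (negbTE kl) mulr0 add0r.
rewrite -[true%:R]/(1 : R); ring.
Qed.

Definition yp (b : R) p : R := p.2 `^ b.
Definition rp (m : R) p : R := rr p `^ (- m).
(* Normalising the coordinates by the radius makes the class of polynomials in
   [yp], [rp], [xr] consist of functions bounded on strips and stable under
   partial derivatives. *)
Definition xr k p : R := hcoord k p * rr p `^ (- 2^-1).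

Lemma is_derive_yp b k p : 0 < p.2 ->
  is_derive p (direction k) (yp b) ((k == None)%:R * (b * yp (b - 1) p)).
Proof.
move=> p0; apply: is_derive_line.
rewrite (_ : (fun h => _) = (fun h : R => (p.2 + (k == None)%:R * h) `^ b)); last first.
  apply/funext => h; rewrite /yp -[_.2]/(hcoord None _) hcoordD hcoordZ hcoord_direction eq_sym.
  by rewrite addrC mulrC.
have p0' : 0 < p.2 + (k == None)%:R * 0 by rewrite mulr0 addr0.
have D1 := is_derive1_powR b p0'.
have D2 : is_derive (0 : R) 1 (fun h : R => p.2 + (k == None)%:R * h) (k == None)%:R.
  by apply: is_derive_eq; rewrite /GRing.scale/=; ring.
have := @is_derive1_comp _ (fun x => x `^ b) (fun h => p.2 + (k == None)%:R * h) 0 _ _ D1 D2.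
rewrite mulr0 addr0 => h; apply: is_derive_eq h _.
by rewrite mulrC.
Qed.

Lemma is_derive_rp m k p : 0 < p.2 ->
  is_derive p (direction k) (rp m) (- (2 * m) * hcoord k p * rp (m + 1) p).
Proof.
move=> p0; apply: is_derive_line.
rewrite (_ : (fun h => _) = (fun h : R => (rr p + 2 * hcoord k p * h + h ^+ 2) `^ (- m))); last first.
  by apply/funext => h; rewrite /rp rr_line.
have r0 := rr_gt0 p0.
have p0' : 0 < rr p + 2 * hcoord k p * 0 + 0 ^+ 2 by rewrite mulr0 addr0 expr0n/= addr0.
have D1 := is_derive1_powR (- m) p0'.
have D2 : is_derive (0 : R) 1 (fun h : R => rr p + 2 * hcoord k p * h + h ^+ 2) (2 * hcoord k p).
  by apply: is_derive_eq; rewrite /GRing.scale/=; ring.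
have := @is_derive1_comp _ (fun x => x `^ (- m)) (fun h => rr p + 2 * hcoord k p * h + h ^+ 2) 0 _ _ D1 D2.
rewrite mulr0 expr0n/= !addr0 => h; apply: is_derive_eq h _.
by rewrite /rp opprD; ring.
Qed.

Lemma is_derive_hcoord k l p : is_derive p (direction l) (hcoord k) (k == l)%:R.
Proof.
apply: is_derive_line.
rewrite (_ : (fun h => _) = (fun h : R => h * (k == l)%:R + hcoord k p)); last first.
  by apply/funext => h; rewrite hcoordD hcoordZ hcoord_direction.
by apply: is_derive_eq; rewrite /GRing.scale/=; ring.
Qed.

Lemma xrE k : xr k = hcoord k * rp 2^-1.
Proof. by []. Qed.

Lemma rpD m1 m2 p : 0 < p.2 -> rp (m1 + m2) p = rp m1 p * rp m2 p.
Proof. by move=> p0; rewrite /rp opprD powR_add// rr_gt0. Qed.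

Lemma is_derive_xr k l p : 0 < p.2 ->
  is_derive p (direction l) (xr k) ((k == l)%:R * rp 2^-1 p - xr k p * xr l p * rp 2^-1 p).
Proof.
move=> p0; rewrite xrE.
have D1 := is_derive_hcoord k l p; have D2 := is_derive_rp 2^-1 l p0.
apply: is_derive_eq; rewrite /xr /GRing.scale/= rpD//.
have -> : rp 1 p = rp 2^-1 p * rp 2^-1 p by rewrite -rpD//; congr rp; field.
by rewrite -[_ `^ _]/(rp 2^-1 p) -[(hcoord k * _) p]/(hcoord k p * rp 2^-1 p); field.
Qed.

Lemma hcoord_continuous k : continuous (hcoord k).
Proof.
case: k => [i|] p.
  apply: (@continuous_comp _ _ _ fst (fun x : 'rV[R]_n => x ord0 i) p); first exact: cvg_fst.
  exact: coord_continuous.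
exact: cvg_snd.
Qed.

Lemma rr_continuous : continuous rr.
Proof.
move=> p; apply: cvgD.
  apply: (@continuous_comp _ _ _ snd (fun y : R => y ^+ 2) p); first exact: cvg_snd.
  exact: exprn_continuous.
by apply: (@continuous_comp _ _ _ fst normsq p); [exact: cvg_fst|exact: continuous_normsq].
Qed.

Lemma powR_continuous_at (b x : R) : 0 < x -> {for x, continuous (fun x : R => x `^ b)}.
Proof.
move=> x0; apply: differentiable_continuous; apply/derivable1_diffP.
by case: (is_derive1_powR b x0).
Qed.

Lemma good0_yp b : good0 (yp b).
Proof.
split.
  move=> p p0; apply: (@continuous_comp _ _ _ snd (fun y : R => y `^ b) p); first exact: cvg_snd.
  exact: powR_continuous_at.
(* On the strip both [y] and [1 / y] are at most [1 / d], which covers either sign of [b]. *)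
move=> d d0; exists (d^-1 `^ `|b|) => p dp pd.
have p0 : 0 < p.2 by exact: lt_le_trans dp.
rewrite ger0_norm ?powR_ge0// /yp; have [b0|b0] := leP 0 b.
  by rewrite ger0_norm//; apply: ge0_ler_powR; rewrite ?nnegrE// ?invr_ge0 ltW.
rewrite ltr0_norm// -[X in X `^ b <= _]invrK -powR_inv1 ?invr_ge0 ?(ltW p0)// -powRrM mulN1r.
apply: ge0_ler_powR; rewrite ?nnegrE ?invr_ge0 ?(ltW p0) ?(ltW d0) ?oppr_ge0 ?(ltW b0)//.
by rewrite lef_pV2 ?posrE.
Qed.

Lemma good0_rp m : 0 <= m -> good0 (rp m).
Proof.
move=> m0; split.
  move=> p p0; apply: (@continuous_comp _ _ _ rr (fun y : R => y `^ (- m)) p); first exact: rr_continuous.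
  exact/powR_continuous_at/rr_gt0.
move=> d d0; exists ((d ^+ 2) `^ (- m)) => p dp pd.
have p0 : 0 < p.2 by exact: lt_le_trans dp.
rewrite ger0_norm ?powR_ge0// /rp !powRN lef_pV2 ?posrE ?powR_gt0 ?rr_gt0 ?exprn_gt0//.
apply: ge0_ler_powR; rewrite ?nnegrE ?sqr_ge0 ?(ltW (rr_gt0 p0))//.
rewrite /rr -[leLHS]addr0 lerD ?normsq_ge0//.
by apply: lerXn2r => //; rewrite nnegrE ltW.
Qed.

Lemma xr_le1 k p : 0 < p.2 -> `|xr k p| <= 1.
Proof.
move=> p0; rewrite /xr normrM (ger0_norm (powR_ge0 _ _)) powRN ler_pdivrMr ?powR_gt0 ?rr_gt0// mul1r.
rewrite powR12_sqrt ?(ltW (rr_gt0 p0))// -sqrtr_sqr ler_wsqrtr//.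
by rewrite rrE (bigD1 k)//= lerDl sumr_ge0// => i _; exact: sqr_ge0.
Qed.

Lemma good0_xr k : good0 (xr k).
Proof.
split.
  move=> p p0; apply: cvgM; first exact: hcoord_continuous.
  by apply: (good0_rp _).1 => //; rewrite invr_ge0.
by move=> d d0; exists 1 => p dp _; apply: xr_le1; exact: lt_le_trans dp.
Qed.

(** A simultaneous induction: differentiating [rp] produces [xr] and [rp], and differentiating [xr]
    produces [xr] and [rp] again. The restriction [0 <= m] keeps [rp m] bounded as |x| grows, and
    differentiation only raises [m]. *)
Lemma good_basic k : [/\ forall b, good k (yp b), forall m, 0 <= m -> good k (rp m) & forall l, good k (xr l)].
Proof.
elim: k => [|k [IHy IHr IHx]].
  by split => [b|m m0|l]; split => //; [exact: good0_yp|exact: good0_rp|exact: good0_xr].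
split => [b|m m0|l]; (split; first by [exact: good0_yp|exact: good0_rp|exact: good0_xr]) => d.
- split; first by move=> p p0; case: (is_derive_yp b d p0).
  apply: (@good_ext _ (cst ((d == None)%:R * b) \* yp (b - 1))); last by apply: goodM => //; exact: good_cst.
  by move=> q q0; case: (is_derive_yp b d q0) => _; rewrite /partial => ->; rewrite /= mulrA.
- split; first by move=> p p0; case: (is_derive_rp m d p0).
  apply: (@good_ext _ (cst (- (2 * m)) \* (xr d \* rp (m + 2^-1)))).
    move=> q q0; case: (is_derive_rp m d q0) => _; rewrite /partial => ->.
    rewrite /= /xr -[_ `^ _]/(rp 2^-1 q) -!mulrA -rpD//; congr (_ * (_ * rp _ _)).
    by field.
  apply: goodM; first exact: good_cst.
  by apply: goodM => //; apply: IHr; rewrite addr_ge0// invr_ge0.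
- split; first by move=> p p0; case: (is_derive_xr l d p0).
  apply: (@good_ext _ ((cst (l == d)%:R \* rp 2^-1) \+ (cst (-1) \* ((xr l \* xr d) \* rp 2^-1)))).
    move=> q q0; case: (is_derive_xr l d q0) => _; rewrite /partial => ->.
    by rewrite /= mulN1r.
  have h : good k (rp 2^-1) by apply: IHr; rewrite invr_ge0.
  apply: goodD; apply: goodM => //; try exact: good_cst.
  by apply: goodM => //; exact: goodM.
Qed.

End good_kernels.

(** * Convolution of a good kernel with an integrable function *)

Section kernel_transform.
Context {R : realType} {n : nat}.
Local Notation V := ('rV[R]_n * R)%type.
Local Notation T := (n.-tuple (measurableTypeR R)).
Local Notation row t := (\row_i tnth t i).
Local Notation mu := (lebesgue_tuple R n).
Variable u : 'rV[R]_n -> R.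
Hypothesis cu : continuous u.
Hypothesis iu : mu.-integrable setT (fun t : T => (u (row t))%:E).
Implicit Types (K L : V -> R) (p q : V).

Definition ktrans K p : R := convolution (fun x => K (x, p.2)) u p.1.

Let ker K p (t : T) : R := K (p.1 - row t, p.2) * u (row t).

Lemma ktrans_ext K L p : 0 < p.2 -> (forall q, 0 < q.2 -> K q = L q) -> ktrans K p = ktrans L p.
Proof. by move=> p0 KL; apply: eq_Rintegral => t _; rewrite KL. Qed.

Let measurable_ker K p : good0 K -> 0 < p.2 -> measurable_fun setT (ker K p).
Proof.
move=> [cK _] p0; apply: measurable_funM; last exact: measurable_tuple_continuous.
apply: (@measurable_tuple_continuous _ _ (fun z => K (p.1 - z, p.2))) => z.
have h : {for z, continuous (fun z : 'rV[R]_n => (p.1 - z, p.2) : V)}.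
  apply: (@continuous_at_pair _ _ _ (fun z : 'rV[R]_n => p.1 - z) (fun=> p.2) z).
    apply: (@continuousB _ _ _ (cst p.1) id z); first exact: cst_continuous.
    by move=> A.
  exact: cst_continuous.
exact: (cvg_comp (fun z : 'rV[R]_n => (p.1 - z, p.2) : V) K h (cK (p.1 - z, p.2) p0)).
Qed.

Let int_abs_u : mu.-integrable setT (fun t : T => `|u (row t)|%:E).
Proof. exact: (integrable_abse iu). Qed.

Let int_scale_u M : mu.-integrable setT (EFin \o (fun t : T => M * `|u (row t)|)).
Proof. exact: (integrableZl measurableT M int_abs_u). Qed.

Lemma near_strip p : 0 < p.2 -> exists2 d : R, 0 < d & \forall q \near p, d < q.2 /\ q.2 < d^-1.
Proof.
(* The first entry puts the lower edge of the strip below [p.2]; the second makes its upper edge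
   [1 / d] at least [p.2 + 1]. *)
move=> p0; pose d := Num.min (p.2 / 2) (p.2 + 1)^-1.
have d0 : 0 < d by rewrite lt_min divr_gt0//= invr_gt0 addr_gt0.
exists d => //; near=> q; split.
- have : d <= p.2 / 2 by rewrite ge_min lexx.
  move/le_lt_trans; apply; near: q.
  by apply: (@cvgr_gt R V (nbhs p) _ snd p.2); [exact: cvg_snd|lra].
- apply: (@lt_le_trans _ _ (p.2 + 1)).
    near: q; apply: (@cvgr_lt R V (nbhs p) _ snd p.2); [exact: cvg_snd|lra].
  by rewrite -[leLHS]invrK lef_pV2 ?posrE ?invr_gt0 ?addr_gt0// ge_min lexx orbT.
Unshelve. all: by end_near. Qed.

Lemma ktrans_continuous K p : good0 K -> 0 < p.2 -> {for p, continuous (ktrans K)}.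
Proof.
move=> gK p0; have [d d0 dp] := near_strip p0; have [M HM] := gK.2 d d0.
apply: (@continuous_param_Rintegral _ _ _ _ _ (ker K) _ _ (int_scale_u M)).
- by near=> q; apply: measurable_ker => //; near: q; exact: near_half_space.
- near=> q => t; rewrite normrM ler_wpM2r// HM//=.
  + by near: q; apply: filterS dp => q [/ltW].
  + by near: q; apply: filterS dp => q [_ /ltW].
- move=> t; apply: cvgM; last exact: cvg_cst.
  apply: (@continuous_comp _ _ _ (fun q : V => (q.1 - row t, q.2)) K); last exact: gK.1.
  apply: (@continuous_at_pair _ _ _ (fun q : V => q.1 - row t) snd p).
    by apply: cvgB; [exact: cvg_fst|exact: cvg_cst].
  exact: cvg_snd.
Unshelve. all: by end_near. Qed.

Lemma ker_integrable K p : good0 K -> 0 < p.2 -> mu.-integrable setT (EFin \o ker K p).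
Proof.
move=> gK p0; have [d d0 /nbhs_singleton[dp pd]] := near_strip p0; have [M HM] := gK.2 d d0.
apply: le_integrable (int_scale_u M) => //; first by apply/measurable_EFinP; exact: measurable_ker.
move=> t _; rewrite lee_fin normrM [leRHS]ger0_norm ?mulr_ge0//.
  by rewrite ler_wpM2r// HM//= ltW.
by apply: le_trans (normr_ge0 _) (HM p _ _); exact: ltW.
Qed.

Lemma ktransZ a K p : good0 K -> 0 < p.2 -> p.2 `^ a * ktrans K p = ktrans (yp a \* K) p.
Proof.
move=> gK p0; rewrite /ktrans /convolution /integral_Rn -RintegralZl//.
  by apply: eq_Rintegral => t _; rewrite mulrA.
exact: ker_integrable.
Qed.

Lemma ktrans_sum (I : Type) (r : seq I) (K : I -> V -> R) p : 0 < p.2 ->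
  (forall i, good0 (K i)) ->
  \sum_(i <- r) ktrans (K i) p = ktrans (fun q => \sum_(i <- r) K i q) p.
Proof.
move=> p0 gK.
have gS r' : good0 (fun q => \sum_(i <- r') K i q).
  elim: r' => [|i r' IH].
    by under eq_fun do rewrite big_nil; exact: (good_cst 0 0).1.
  by under eq_fun do rewrite big_cons; exact: good0D.
elim: r => [|i r IH].
  rewrite big_nil /ktrans /convolution /integral_Rn; apply/esym.
  under eq_Rintegral do rewrite big_nil mul0r.
  by rewrite /Rintegral integral0.
rewrite big_cons IH /ktrans /convolution /integral_Rn -RintegralD//.
- by apply: eq_Rintegral => t _; rewrite big_cons mulrDl.
- exact: ker_integrable.
- exact: (ker_integrable (gS r) p0).
Qed.

(** A short segment through [p] in direction [k] stays in a strip. There the derivative of the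
    integrand is dominated by [M * |u|], with [M] the bound of [partial k K] on that strip. *)
Lemma ktrans_derive K p (k : option 'I_n) : good 1 K -> 0 < p.2 ->
  is_derive p (direction k) (ktrans K) (ktrans (partial k K) p).
Proof.
move=> [gK dK] p0; have [dK1 [gK' _]] := dK k.
have [d d0 dp] := near_strip p0; have [M HM] := gK'.2 d d0.
apply: is_derive_line.
have : \forall h \near (0 : R), d < (h *: direction k + p).2 /\ (h *: direction k + p).2 < d^-1.
  have : {for 0, continuous (fun h : R => h *: direction k + p)}.
    apply: cvgD; last exact: cvg_cst.
    by apply: cvgZl; exact: cvg_id.
  by rewrite /prop_for /continuous_at scale0r add0r => /(_ _ dp).
move=> /nbhs_ballP[e /= e0 He].
have Hs (h : R) : h \in `]- e, e[ -> d < (h *: direction k + p).2 /\ (h *: direction k + p).2 < d^-1.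
  by move=> h0; apply: He; rewrite /ball/= sub0r normrN ltr_norml; move: h0; rewrite in_itv.
have Hp (h : R) : h \in `]- e, e[ -> 0 < (h *: direction k + p).2.
  by move=> /Hs[h1 _]; exact: lt_trans h1.
pose f (h : R) (t : T) := ker K (h *: direction k + p) t.
have I0 : `]- e, e[%classic 0 by rewrite /= in_itv/= oppr_lt0 e0.
have intf h : `]- e, e[%classic h -> mu.-integrable setT (EFin \o f h).
  by move=> /Hp h0; exact: ker_integrable.
have Df h t : `]- e, e[%classic h -> is_derive h 1 (f ^~ t) (ker (partial k K) (h *: direction k + p) t).
  move=> /Hp h0; rewrite /f /ker.
  have D1 : is_derive h 1 (fun h : R => K (h *: direction k + (p.1 - row t, p.2)))
      (partial k K (h *: direction k + (p.1 - row t, p.2))).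
    by apply: is_derive_lineV; split => //; exact: dK1.
  have E (h' : R) : ((h' *: direction k + p).1 - row t, (h' *: direction k + p).2) = h' *: direction k + (p.1 - row t, p.2) :> V.
    by apply: (f_equal2 pair) => //; exact: esym (addrA _ _ _).
  have -> : (fun h' : R => K ((h' *: direction k + p).1 - row t, (h' *: direction k + p).2) * u (row t)) =
      (fun h' => K (h' *: direction k + (p.1 - row t, p.2))) * cst (u (row t)).
    by apply/funext => h'; rewrite E.
  by apply: is_derive_eq; rewrite scaler0 add0r E /GRing.scale/= mulrC.
have derf h t : `]- e, e[%classic h -> setT t -> derivable (f ^~ t) h 1.
  by move=> h0 _; case: (Df h t h0).
have M0 : 0 <= M.
  by have [dp1 dp2] := nbhs_singleton dp; apply: le_trans (normr_ge0 _) (HM p _ _); exact: ltW.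
have bndf h t : `]- e, e[%classic h -> setT t -> `|partial1of2 f h t| <= M * `|u (row t)|.
  move=> h0 _; rewrite partial1of2E; case: (Df h t h0) => _ ->.
  by rewrite normrM ler_wpM2r// HM//=; case: (Hs h h0) => ? ?; exact: ltW.
have G0 t : 0 <= M * `|u (row t)| by rewrite mulr_ge0.
split; first exact: (derivable_under_integral measurableT I0 intf derf G0 (int_scale_u M) bndf).
have := differentiation_under_integral measurableT I0 intf derf G0 (int_scale_u M) bndf.
rewrite derive1E => ->; apply: eq_Rintegral => t _.
by rewrite partial1of2E; case: (Df 0 t I0) => _ ->; rewrite scale0r add0r.
Qed.

End kernel_transform.

(** * The Poisson integral *)

Section affine_Rn.
Context {R : realType} {n : nat}.
Local Notation T := (n.-tuple (measurableTypeR R)).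
Local Notation row t := (\row_i tnth t i).
Local Notation mu := (lebesgue_tuple R n).

(** The nonnegative case applied to the positive and negative parts. Both transformed integrals are
    finite since [|y| ^ n] is positive, so the factor distributes over their difference. *)
Lemma integral_Rn_affine (f : 'rV[R]_n -> R) (c : 'rV[R]_n) (y : R) : y != 0 ->
  mu.-integrable setT (fun t : T => (f (row t))%:E) ->
  integral_Rn f = `|y| ^+ n * integral_Rn (fun w => f (c + y *: w)).
Proof.
move=> y0 fi; have mf := measurable_int _ fi.
have k0 : 0 < `|y| ^+ n by rewrite exprn_gt0// normr_gt0.
pose aff (t : T) : T := mktuple (fun i => c ord0 i + y * tnth t i).
have affE t : row (aff t) = c + y *: row t.
  by apply/rowP => i; rewrite !mxE tnth_mktuple.
pose F (t : T) : \bar R := (f (row t))%:E.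
have fp : (\int[mu]_t F^\+ t)%E = ((`|y| ^+ n)%:E * \int[mu]_t F^\+ (aff t))%E.
  by apply: ge0_integral_tuple_affine => //; exact: measurable_funepos.
have fn : (\int[mu]_t F^\- t)%E = ((`|y| ^+ n)%:E * \int[mu]_t F^\- (aff t))%E.
  by apply: ge0_integral_tuple_affine => //; exact: measurable_funeneg.
have Ap0 : (0 <= \int[mu]_t F^\+ (aff t))%E by exact: integral_ge0.
have An0 : (0 <= \int[mu]_t F^\- (aff t))%E by exact: integral_ge0.
have Ap : (\int[mu]_t F^\+ (aff t))%E \is a fin_num.
  have := integrable_pos_fin_num measurableT fi; rewrite fp.
  by case: (\int[mu]_t F^\+ (aff t))%E Ap0 => //; rewrite mulry gtr0_sg// mul1e.
have An : (\int[mu]_t F^\- (aff t))%E \is a fin_num.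
  have := integrable_neg_fin_num measurableT fi; rewrite fn.
  by case: (\int[mu]_t F^\- (aff t))%E An0 => //; rewrite mulry gtr0_sg// mul1e.
rewrite /integral_Rn /Rintegral.
rewrite [in LHS]integralE -/F fp fn.
rewrite [X in _ = _ * fine X](_ : _ = \int[mu]_t F (aff t))%E; last first.
  by apply: eq_integral => t _; rewrite /F affE.
rewrite [in RHS]integralE.
rewrite (_ : (fun t => F (aff t))^\+ = fun t => F^\+ (aff t))%E; last by apply/funext => t; rewrite !funeposE.
rewrite (_ : (fun t => F (aff t))^\- = fun t => F^\- (aff t))%E; last by apply/funext => t; rewrite !funenegE.
move: Ap An; case: (\int[mu]_t F^\+ (aff t))%E => //= A _; case: (\int[mu]_t F^\- (aff t))%E => //= B _.
by rewrite mulrBr.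
Qed.

End affine_Rn.

(** * Bounds and integrability of Schwartz functions *)

Section schwartz_facts.
Context {R : realType} {n : nat}.
Variable u : 'rV[R]_n -> R.
Hypothesis hu : schwartz u.
Local Notation T := (n.-tuple (measurableTypeR R)).
Local Notation row t := (\row_i tnth t i).
Local Notation mu := (lebesgue_tuple R n).

Lemma schwartz_continuous : continuous u.
Proof. exact: (hu.1 [::]).1. Qed.

Lemma schwartz_bounded (b : seq 'I_n) : exists M : R, forall x, `|iter_partial b u x| <= M.
Proof. by have [C HC] := hu.2 b 0; exists C => x; have := HC x; rewrite expr0 mul1r. Qed.

Lemma schwartz_integrable : mu.-integrable setT (fun t : T => (u (row t))%:E).
Proof.
(* Decay of order [n + 2] suffices: [(1 + |x|)^(n+2)] dominates [(1 + |x|^2)^(n/2+1)], whose inverse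
   is the case [s = b = 1] of [bessel_integrable]. *)
have [C HC] := hu.2 [::] n.+2.
have := integrableZl measurableT C (@bessel_integrable R n 1 1 ltr01 ltr01).
apply: le_integrable => //.
  apply/measurable_EFinP; apply: measurable_tuple_continuous; exact: schwartz_continuous.
move=> t _; rewrite lee_fin; apply: le_trans (ler_norm _).
have e0 : 0 <= enorm (row t) by rewrite sqrtr_ge0.
have d0 : 0 < (1 + normsq (row t)) `^ (n%:R / 2 + 1).
  by rewrite powR_gt0// ltr_wpDr// normsq_ge0.
rewrite powRN -[X in _ <= _ * X]/((_ `^ _)^-1) ler_pdivlMr//; apply: le_trans (HC (row t)).
rewrite mulrC ler_wpM2r//= -powR_mulrn ?addr_ge0// -enorm_sqr.
apply: (@le_trans _ _ (((1 + enorm (row t)) ^+ 2) `^ (n%:R / 2 + 1))).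
  apply: ge0_ler_powR; rewrite ?nnegrE ?sqr_ge0//.
  - by rewrite addr_ge0// sqr_ge0.
  - by rewrite sqrrD expr1n mul1r; lra.
rewrite -powR_mulrn ?addr_ge0// -powRrM le_eqVlt; apply/orP; left; apply/eqP; congr (_ `^ _).
by rewrite -[n.+2]addn2 natrD; field.
Qed.

End schwartz_facts.

(** * The Poisson kernel and its differential equation *)

Section poisson.
Context {R : realType} {n : nat}.
Variable s : R.
Hypotheses (s0 : 0 < s).
Local Notation V := ('rV[R]_n * R)%type.
Local Notation T := (n.-tuple (measurableTypeR R)).
Local Notation row t := (\row_i tnth t i).
Local Notation mu := (lebesgue_tuple R n).
Let m : R := n%:R / 2 + s.
Let C : R := Gamma m / (pi `^ (n%:R / 2) * Gamma s).

Definition pker (p : V) : R := poisson_kernel s p.1 p.2.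

Let m0 : 0 < m. Proof. by rewrite ltr_wpDl// divr_ge0. Qed.

Lemma poisson_constant_gt0 : 0 < C.
Proof. by rewrite divr_gt0 ?mulr_gt0 ?Gamma_gt0 ?powR_gt0 ?pi_gt0. Qed.
Let C0 := poisson_constant_gt0.

Lemma pkerE p : pker p = C * (yp (2 * s) p * rp m p).
Proof.
rewrite /pker /poisson_kernel -/m -/C /yp /rp /rr powRN enorm_sqr.
by congr (_ * (_ / _ `^ _)); rewrite /m; field.
Qed.

Lemma pker_ge0 p : 0 <= pker p.
Proof. by rewrite pkerE mulr_ge0 ?(ltW C0)// mulr_ge0 ?powR_ge0. Qed.

Lemma good_pker k : good k pker.
Proof.
have [Hy Hr _] := @good_basic R n k.
apply: (@good_ext _ _ _ (cst C \* (yp (2 * s) \* rp m))); first by move=> q _; rewrite pkerE.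
by apply: goodM; [exact: good_cst|apply: goodM => //; apply: Hr; exact: ltW].
Qed.

Lemma measurable_pker y : measurable_fun setT (fun t : T => pker (row t, y)).
Proof.
rewrite (_ : (fun t => _) = (fun t => C * (y `^ (2 * s) * (y ^+ 2 + normsq (row t)) `^ (- m)))); last first.
  by apply/funext => t; rewrite pkerE.
by apply: measurable_funM => //; apply: measurable_funM => //; exact: measurable_bessel.
Qed.

(** [C] is the reciprocal of the constant in [bessel_integral], and for [b = y^2] the factor
    [b ^ (- s)] cancels [y ^ (2 s)]. *)
Lemma integral_pker y : 0 < y -> (\int[mu]_t (pker (row t, y))%:E = 1)%E.
Proof.
move=> y0; have y20 : 0 < y ^+ 2 by rewrite exprn_gt0.
have C1 : 0 <= C * y `^ (2 * s) by rewrite mulr_ge0 ?powR_ge0// ltW.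
transitivity ((C * y `^ (2 * s))%:E * \int[mu]_t ((y ^+ 2 + normsq (row t)) `^ (- m))%:E)%E.
  rewrite -ge0_integralZl_EFin//; last 2 first.
  - by move=> t _; rewrite lee_fin powR_ge0.
  - by apply/measurable_EFinP; exact: measurable_bessel.
  by apply: eq_integral => t _; rewrite pkerE -EFinM mulrA.
rewrite bessel_integral// -/m -EFinM; congr EFin.
rewrite -powR_mulrn ?(ltW y0)// -powRrM mulrN powRN /C.
field; rewrite ?gt_eqF ?mulr_gt0 ?Gamma_gt0 ?powR_gt0 ?pi_gt0//.
Qed.

Lemma pker_integrable y : 0 < y -> mu.-integrable setT (fun t : T => (pker (row t, y))%:E).
Proof.
move=> y0; apply/integrableP; split; first by apply/measurable_EFinP; exact: measurable_pker.
under eq_integral do rewrite gee0_abs ?lee_fin ?pker_ge0//.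
by rewrite integral_pker// ltry.
Qed.

(** The kernel is homogeneous of degree [2 s - 2 m = - n], so it absorbs the Jacobian of the
    dilation by [y]. *)
Lemma pker_scale (w : 'rV[R]_n) y : 0 < y -> y ^+ n * pker (y *: w, y) = pker (w, 1).
Proof.
move=> y0; rewrite !pkerE mulrCA; congr (_ * _).
rewrite /yp /rp /rr/= powR1 mul1r expr1n.
have -> : y ^+ 2 + normsq (y *: w) = y ^+ 2 * (1 + normsq w).
  rewrite mulrDr mulr1; congr (_ + _); rewrite /normsq mulr_sumr; apply: eq_bigr => i _.
  by rewrite mxE exprMn.
rewrite powRM ?sqr_ge0 ?addr_ge0 ?normsq_ge0// !mulrA -[RHS]mul1r; congr (_ * _).
rewrite -!powR_mulrn ?(ltW y0)// -powRrM -!powR_add//.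
by rewrite (_ : _ + _ = 0) ?powRr0// /m; field.
Qed.

Lemma pker_le p : 0 < p.2 -> pker p <= C * p.2 ^- n.
Proof.
move=> p0; rewrite pkerE ler_pM2l// /yp /rp.
have h : rr p `^ (- m) <= (p.2 ^+ 2) `^ (- m).
  rewrite !powRN lef_pV2 ?posrE ?powR_gt0 ?rr_gt0 ?exprn_gt0//.
  by apply: ge0_ler_powR; rewrite ?nnegrE ?sqr_ge0 ?(ltW m0) ?(ltW (rr_gt0 p0))// lerDl normsq_ge0.
apply: le_trans (ler_wpM2l (powR_ge0 _ _) h) _.
rewrite -[p.2 ^- n]powR_invn ?(ltW p0)// -powR_mulrn ?(ltW p0)// -powRrM -powR_add//.
by rewrite (_ : _ + _ = - n%:R)// /m; field.
Qed.

(* The flux y^a dP/dx_k, with the powers of y simplified. *)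
Definition pflux (k : option 'I_n) : V -> R :=
  cst (C * ((k == None)%:R * (2 * s))) * rp m - cst (C * (2 * m)) * (hcoord k * hcoord None * rp (m + 1)).

Lemma pfluxE k q : 0 < q.2 -> yp (1 - 2 * s) q * partial k pker q = pflux k q.
Proof.
move=> q0.
have D1 := is_derive_yp (2 * s) k q0; have D2 := is_derive_rp m k q0.
have : is_derive q (direction k) (cst C * (yp (2 * s) * rp m))
    (C * (yp (2 * s) q * (- (2 * m) * hcoord k q * rp (m + 1) q) +
          rp m q * ((k == None)%:R * (2 * s * yp (2 * s - 1) q)))).
  by apply: is_derive_eq; rewrite scaler0 addr0.
rewrite (_ : cst C * _ = pker); last by apply/funext => q'; rewrite pkerE.
move=> [_]; rewrite /partial => ->.
have h1 : yp (1 - 2 * s) q * yp (2 * s) q = q.2.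
  by rewrite /yp -powR_add// subrK powRr1// ltW.
have h2 : yp (1 - 2 * s) q * yp (2 * s - 1) q = 1.
  by rewrite /yp -powR_add// addrA subrK subrr powRr0.
transitivity (C * ((yp (1 - 2 * s) q * yp (2 * s) q) * (- (2 * m) * hcoord k q * rp (m + 1) q) +
          rp m q * ((k == None)%:R * (2 * s * (yp (1 - 2 * s) q * yp (2 * s - 1) q))))).
  by ring.
rewrite h1 h2.
change (C * (q.2 * (- (2 * m) * hcoord k q * rp (m + 1) q) + rp m q * ((k == None)%:R * (2 * s * 1))) =
  C * ((k == None)%:R * (2 * s)) * rp m q - C * (2 * m) * (hcoord k q * q.2 * rp (m + 1) q)).
by ring.
Qed.

(** The squares of the coordinates sum to [rr], so after summation every term is a multiple of
    [y * rp (m + 1)]. The coefficients add up to a multiple of [2 (m + 1) - (2 s + 1) - (n + 1)],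
    which is 0 for [m = n/2 + s]. *)
Lemma pker_pde p : 0 < p.2 ->
  \sum_k partial k (yp (1 - 2 * s) \* partial k pker) p = 0.
Proof.
move=> p0.
have DM k : partial k (pflux k) p =
   C * (2 * m) * rp (m + 1) p * (- (2 * s) - 1) * ((k == None)%:R * hcoord k p) +
   (- (C * (2 * m) * p.2 * rp (m + 1) p) + C * (2 * m) * (2 * (m + 1)) * p.2 * rp (m + 1 + 1) p * hcoord k p ^+ 2).
  have D1 := is_derive_rp m k p0; have D2 := is_derive_rp (m + 1) k p0.
  have D3 := is_derive_hcoord k k p; have D4 := is_derive_hcoord None k p.
  have : is_derive p (direction k) (pflux k)
    (C * ((k == None)%:R * (2 * s)) * (- (2 * m) * hcoord k p * rp (m + 1) p)
     - C * (2 * m) * ((hcoord k p * p.2) * (- (2 * (m + 1)) * hcoord k p * rp (m + 1 + 1) p) +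
          rp (m + 1) p * (hcoord k p * (k == None)%:R + p.2))).
    apply: is_derive_eq.
    rewrite !scaler0 !addr0 eqxx eq_sym /GRing.scale/= mulr1//.
  move=> [_]; rewrite /partial => ->; ring.
rewrite (eq_bigr (fun k => partial k (pflux k) p)); last first.
  by move=> k _; apply: partial_ext => // q q0; rewrite /= pfluxE.
rewrite (eq_bigr _ (fun k _ => DM k)) !big_split/= -!mulr_sumr -rrE.
rewrite sumr_const card_option card_ord.
rewrite (bigD1 None)//= mul1r big1 ?addr0; last by case=> // i _; rewrite mul0r.
have -> : rp (m + 1) p = rr p * rp (m + 1 + 1) p.
  have r0 := rr_gt0 p0.
  by rewrite -[X in X * _]powRr1 ?(ltW r0)// /rp -powR_add//; congr (_ `^ _); ring.
rewrite -[_ *+ n.+1]mulr_natr.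
have -> : n.+1%:R = 2 * (m - s) + 1 :> R by rewrite -natr1 /m; field.
ring.
Qed.

(** * The extension of Schwartz boundary data *)

Section solution.
Variable u : 'rV[R]_n -> R.
Hypothesis hu : schwartz u.
Let cu := schwartz_continuous hu.
Let iu := schwartz_integrable hu.

(* For y > 0 this is the convolution with P(., y) after the substitution
   z = x - y w; in this form it also makes sense at y = 0. *)
Definition poisson_ext (p : V) : R := integral_Rn (fun w => pker (w, 1) * u (p.1 - p.2 *: w)).

Let const_bound M : mu.-integrable setT (EFin \o (fun t : T => M * pker (row t, 1))).
Proof. exact: (integrableZl measurableT M (pker_integrable ltr01)). Qed.

Lemma measurable_poisson_ext (p : V) :
  measurable_fun setT (fun t : T => pker (row t, 1) * u (p.1 - p.2 *: row t)).
Proof.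
apply: measurable_funM; first exact: measurable_pker.
apply: (@measurable_tuple_continuous _ _ (fun z => u (p.1 - p.2 *: z))) => z.
have h : {for z, continuous (fun z : 'rV[R]_n => p.1 - p.2 *: z)}.
  apply: (@continuousB _ _ _ (cst p.1) _ z); first exact: cst_continuous.
  exact: scaler_continuous.
exact: (continuous_comp h (@cu _)).
Qed.

Lemma poisson_ext_integrable (p : V) :
  mu.-integrable setT (EFin \o (fun t : T => pker (row t, 1) * u (p.1 - p.2 *: row t))).
Proof.
have [M HM] := schwartz_bounded hu [::].
apply: le_integrable (const_bound M) => //.
  by apply/measurable_EFinP; exact: measurable_poisson_ext.
move=> t _; rewrite lee_fin normrM mulrC [leRHS]normrM ler_wpM2r//.
by rewrite (le_trans (HM _))// ler_norm.
Qed.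

Lemma poisson_extE (p : V) : 0 < p.2 -> poisson_ext p = ktrans u pker p.
Proof.
move=> p0; rewrite /ktrans /convolution.
have := ker_integrable cu iu (good_pker 0).1 p0 => /= fi.
have y0 : - p.2 != 0 by rewrite oppr_eq0 gt_eqF.
rewrite (@integral_Rn_affine _ _ (fun z => pker (p.1 - z, p.2) * u z) p.1 (- p.2))//.
rewrite normrN gtr0_norm// /integral_Rn.
rewrite [X in _ * X](_ : _ = \int[mu]_t (p.2 ^- n * (pker (row t, 1) * u (p.1 - p.2 *: row t)))); last first.
  apply: eq_Rintegral => t _; rewrite opprD addNKr scaleNr opprK -(pker_scale _ p0).
  have yn : p.2 ^+ n != 0 by rewrite gt_eqF// exprn_gt0.
  by rewrite -(mulrA (p.2 ^+ n)) mulKf.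
by rewrite RintegralZl ?mulrA ?divff ?mul1r ?gt_eqF ?exprn_gt0//; exact: poisson_ext_integrable.
Qed.

Lemma poisson_ext_continuous : continuous poisson_ext.
Proof.
have [M HM] := schwartz_bounded hu [::].
move=> p; apply: (@continuous_param_Rintegral _ _ _ _ _ (fun (q : V) (t : T) => pker (row t, 1) * u (q.1 - q.2 *: row t)) p _ (const_bound M)).
- by near=> q; exact: measurable_poisson_ext.
- by near=> q => t; rewrite normrM mulrC (ger0_norm (pker_ge0 _)) ler_wpM2r ?pker_ge0//; exact: HM.
- move=> t; apply: cvgM; first exact: cvg_cst.
  have h : {for p, continuous (fun q : V => q.1 - q.2 *: row t)}.
    apply: cvgB; first exact: cvg_fst.
    by apply: cvgZl; exact: cvg_snd.
  exact: (continuous_comp h (@cu _)).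
Unshelve. all: by end_near. Qed.

Lemma Rintegral_pker y : 0 < y -> \int[mu]_t pker (row t, y) = 1.
Proof. by move=> y0; rewrite /Rintegral integral_pker. Qed.

Lemma poisson_ext0 x : poisson_ext (x, 0) = u x.
Proof.
rewrite /poisson_ext/=.
under eq_fun do rewrite scale0r subr0.
by rewrite /integral_Rn RintegralZr ?Rintegral_pker ?mul1r//; exact: pker_integrable.
Qed.

Lemma poisson_ext_bounded : exists M : R, forall p, `|poisson_ext p| <= M.
Proof.
have [M HM] := schwartz_bounded hu [::]; exists M => p.
apply: (le_trans (le_normr_Rintegral measurableT (poisson_ext_integrable p))).
apply: (@le_trans _ _ (\int[mu]_t (M * pker (row t, 1)))); last first.
  by rewrite RintegralZl ?Rintegral_pker ?mulr1//; exact: pker_integrable.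
apply: le_Rintegral => //.
- exact: (integrable_abse (poisson_ext_integrable p)).
- move=> t _; rewrite normrM mulrC (ger0_norm (pker_ge0 _)) ler_wpM2r ?pker_ge0//; exact: HM.
Qed.

(** The kernel is at most [C / y^n], and for [y > 1] the assumption [0 < n] bounds this by [C / y];
    integrability of [u] does the rest. For [n = 0] the extension would be constant in [y]. *)
Lemma poisson_ext_cvg0 : (0 < n)%N -> forall x, poisson_ext (x, y) @[y --> +oo] --> 0.
Proof.
move=> n0 x.
pose A := \int[mu]_t `|u (row t)|.
have bnd y : 1 < y -> `|poisson_ext (x, y)| <= C * A * y^-1.
  move=> y1; have y0 : 0 < y by exact: lt_trans y1.
  rewrite poisson_extE// /ktrans/=.
  apply: (le_trans (le_normr_Rintegral measurableT _)).
    by have := ker_integrable cu iu (good_pker 0).1 (y0 : 0 < (x, y).2).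
  rewrite mulrAC -RintegralZl//; last by have := integrable_abse iu.
  apply: le_Rintegral => //.
  - exact: (integrable_abse (ker_integrable cu iu (good_pker 0).1 (y0 : 0 < (x, y).2))).
  - exact: (integrableZl measurableT (C * y^-1) (integrable_abse iu)).
  - move=> t _; rewrite normrM ler_wpM2r// ger0_norm ?pker_ge0//.
    apply: le_trans (pker_le _) _ => //=; rewrite ler_pM2l// lef_pV2 ?posrE ?exprn_gt0//.
    by rewrite ler_eXnr// ltW.
apply/norm_cvg0P; apply: (@squeeze_cvgr _ _ _ _ (cst 0) (fun y => C * A * y^-1)).
- near=> y; rewrite normr_ge0/= bnd//; near: y; exact: nbhs_pinfty_gt.
- exact: cvg_cst.
- rewrite -[X in _ --> X](mulr0 (C * A)); apply: cvgMr.
  apply/gtr0_cvgV0; last exact: cvg_id.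
  by near=> y; near: y; exact: nbhs_pinfty_gt.
Unshelve. all: by end_near. Qed.

Lemma is_derive_poisson_ext (p : V) k : 0 < p.2 ->
  is_derive p (direction k) poisson_ext (ktrans u (partial k pker) p).
Proof.
move=> p0; have [d e] := ktrans_derive cu iu k (good_pker 1) p0.
have E q : 0 < q.2 -> ktrans u pker q = poisson_ext q by move=> q0; rewrite poisson_extE.
by split; [exact: derivable_ext d|rewrite -e; apply/esym/partial_ext].
Qed.

Lemma partial_poisson_ext (p : V) k : 0 < p.2 ->
  partial k poisson_ext p = ktrans u (partial k pker) p.
Proof. by case/(@is_derive_poisson_ext p k). Qed.

Lemma poisson_ext_C2 : C2_upper_half_space poisson_ext.
Proof.
move=> p p0; split; first exact: poisson_ext_continuous.
move=> k; have gk : good 1 (partial k pker) := ((good_pker 2).2 k).2.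
have E q : 0 < q.2 -> ktrans u (partial k pker) q = partial k poisson_ext q.
  by move=> q0; rewrite partial_poisson_ext.
split.
- by case: (is_derive_poisson_ext k p0).
- by apply: (continuous_ext E p0); apply: ktrans_continuous => //; exact: gk.1.
- move=> l; split.
    by apply: (derivable_ext E p0); case: (ktrans_derive cu iu l gk p0).
  apply: (@continuous_ext _ _ (ktrans u (partial l (partial k pker)))) => //.
    by move=> q q0; rewrite -(partial_ext l E q0); case: (ktrans_derive cu iu l gk q0).
  by apply: ktrans_continuous => //; exact: (gk.2 l).2.1.
Qed.

(** The weight [y ^ a] does not depend on the integration variable, so weight, derivatives and sum
    all pass to the kernel, where [pker_pde] applies. *)
Lemma poisson_ext_pde (p : V) : 0 < p.2 -> weighted_divergence (1 - 2 * s) poisson_ext p = 0.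
Proof.
move=> p0; set a := 1 - 2 * s.
have gL k : good 1 (yp a \* partial k pker).
  have [gy _ _] := @good_basic R n 1.
  by apply: goodM => //; exact: ((good_pker 2).2 k).2.
rewrite /weighted_divergence.
rewrite (eq_bigr (fun k => ktrans u (partial k (yp a \* partial k pker)) p)); last first.
  move=> k _; rewrite (@partial_ext _ _ _ (ktrans u (yp a \* partial k pker)))//.
    by case: (ktrans_derive cu iu k (gL k) p0).
  move=> q q0; rewrite partial_poisson_ext// ktransZ//.
  exact: ((good_pker 1).2 k).2.1.
rewrite ktrans_sum//; last by move=> k; exact: ((gL k).2 k).2.1.
rewrite (@ktrans_ext _ _ _ _ (cst 0))//; last by move=> q q0; exact: pker_pde.
rewrite /ktrans /convolution /integral_Rn.
by under eq_Rintegral do rewrite mul0r; rewrite /Rintegral integral0.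
Qed.

End solution.
End poisson.

(** * The flux at the boundary *)

Section Gamma_recurrence.
Context {R : realType}.

(** The integral [F r] equals [Gamma p * r ^ (- p)]. Its derivative at [r = 1] is [- Gamma (p + 1)]
    under the integral sign and [- p * Gamma p] in closed form. *)
Lemma Gamma_succ (p : R) : 0 < p -> Gamma (p + 1) = p * Gamma p.
Proof.
move=> p0; have p10 : 0 < p + 1 by rewrite addr_gt0.
pose f (r t : R) := t `^ (p - 1) * expR (- (t * r)).
pose F (r : R) := \int[@lebesgue_measure R]_(t in `]0, +oo[) f r t.
have FE r : 0 < r -> F r = Gamma p * r `^ (- p).
  by move=> r0; rewrite /F /Rintegral powR_expR_integral//= powRN.
(* Dominates the derivative of the integrand in [r] for all [r] between 1/2 and 2. *)
pose G (t : R) := t `^ p * expR (- (t * 2^-1)).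
have half0 : 0 < 2^-1 :> R by rewrite invr_gt0.
have I1 : `](2^-1 : R), 2[%classic (1 : R) by rewrite /= in_itv/=; apply/andP; split; lra.
have mB : measurable (`]0%R, +oo[%classic : set (measurableTypeR R)) by [].
have meas (q r : R) : measurable_fun (`]0%R, +oo[%classic : set (measurableTypeR R))
    (fun t : R => (t `^ q * expR (- (t * r)))%:E).
  apply/measurable_EFinP/measurable_funTS.
  apply: measurable_funM; first exact: measurable_powR.
  by apply: measurableT_comp => //; apply: measurable_funN => //; exact: measurable_funM.
have int (q r : R) : 0 < q -> 0 < r -> (@lebesgue_measure R).-integrable `]0, +oo[
    (fun t : R => (t `^ (q - 1) * expR (- (t * r)))%:E).
  move=> q0 r0; apply/integrableP; split; first exact: meas.
  under eq_integral do rewrite gee0_abs ?lee_fin ?mulr_ge0 ?powR_ge0 ?expR_ge0//.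
  by rewrite powR_expR_integral// ltry.
have intf r : `](2^-1 : R), 2[%classic r -> (@lebesgue_measure R).-integrable `]0, +oo[ (EFin \o f r).
  by rewrite /= in_itv/= => /andP[r2 _]; apply: int => //; exact: lt_trans r2.
have Df (r t : R) : is_derive r 1 (f ^~ t) (- (t `^ (p - 1) * t * expR (- (t * r)))).
  by rewrite /f; apply: is_derive_eq; rewrite /GRing.scale/=; ring.
have derf (r : R) t : `](2^-1 : R), 2[%classic r -> `]0, +oo[%classic t -> derivable (f ^~ t) r 1.
  by move=> _ _; case: (Df r t).
have tE (t : R) : 0 < t -> t `^ (p - 1) * t = t `^ p.
  by move=> t0; rewrite mulrC mulr_powRB1// ltW.
have G0 t : 0 <= G t by rewrite mulr_ge0 ?powR_ge0 ?expR_ge0.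
have intG : (@lebesgue_measure R).-integrable `]0, +oo[ (EFin \o G).
  by have := int (p + 1) 2^-1 p10 half0; rewrite addrK.
have bndf (r : R) t : `](2^-1 : R), 2[%classic r -> `]0, +oo[%classic t -> `|partial1of2 f r t| <= G t.
  rewrite /= !in_itv/= andbT => /andP[r2 _] t0; rewrite partial1of2E; case: (Df r t) => _ ->.
  rewrite normrN ger0_norm ?mulr_ge0 ?powR_ge0 ?expR_ge0 ?(ltW t0)// tE// /G ler_wpM2l ?powR_ge0//.
  by rewrite ler_expR lerN2 ler_pM2l// ltW.
have := differentiation_under_integral mB I1 intf derf G0 intG bndf.
rewrite -/F derive1E.
have -> : 'D_1 F 1 = 'D_1 (fun r => Gamma p * r `^ (- p)) 1.
  apply: near_eq_derive; near=> r; apply: FE; near: r; exact: lt_nbhsr.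
have D1 := is_derive1_powR (- p) (@ltr01 R).
have -> : 'D_1 (fun r => Gamma p * r `^ (- p)) 1 = - (p * Gamma p).
  have : is_derive (1 : R) 1 (fun r => Gamma p * r `^ (- p)) (- (p * Gamma p)).
    by apply: is_derive_eq; rewrite powR1 /GRing.scale/=; ring.
  by case.
move=> h; apply: oppr_inj; rewrite h /Gamma.
rewrite -[LHS]mulN1r.
have Gi : (@lebesgue_measure R).-integrable `]0, +oo[ (EFin \o (fun t : R => t `^ (p + 1 - 1) * expR (- t))).
  exact: Gamma_integrable.
rewrite -(RintegralZl (-1) mB Gi).
apply: eq_Rintegral => t; rewrite inE/= in_itv/= andbT => t0.
rewrite partial1of2E; case: (Df 1 t) => _ ->.
by rewrite mulr1 tE// addrK mulN1r.
Unshelve. all: by end_near. Qed.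

End Gamma_recurrence.

(** * Second differences of Schwartz functions *)

Section second_difference.
Context {R : realType} {n : nat}.
Local Notation e i := (delta_mx ord0 i : 'rV[R]_n).

(** Only partial derivatives are at hand, so the path from 0 to [w] changes one coordinate at a
    time: [wk k] keeps the first [k] coordinates of [w]. Each step is a one-variable mean value
    theorem inside the cube of radius [rho]. *)
Lemma partials_lipschitz (f : 'rV[R]_n -> R) (C rho : R) (w : 'rV[R]_n) :
  (forall i (x : 'rV[R]_n), (forall j, `|x ord0 j| <= rho) -> derivable f x (e i) /\ `|'D_(e i) f x| <= C) ->
  (forall j, `|w ord0 j| <= rho) ->
  `|f w - f 0| <= C * \sum_j `|w ord0 j|.
Proof.
move=> Hf Hw.
pose wk k : 'rV[R]_n := \row_j (if (j < k)%N then w ord0 j else 0).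
have rho0 (i : 'I_n) : 0 <= rho by exact: le_trans (Hw i).
suff H k : (k <= n)%N -> `|f (wk k) - f 0| <= C * \sum_(j < n | (j < k)%N) `|w ord0 j|.
  have := H n (leqnn n); rewrite (_ : wk n = w); last by apply/rowP => j; rewrite mxE ltn_ord.
  by rewrite (eq_bigl xpredT)// => j; rewrite ltn_ord.
elim: k => [|k IHk] kn.
  rewrite (_ : wk 0 = 0); last by apply/rowP => j; rewrite !mxE.
  by rewrite subrr normr0 big_pred0// mulr0.
pose i := Ordinal kn; pose a := w ord0 i.
have wkS : wk k.+1 = a *: e i + wk k.
  apply/rowP => j; rewrite !mxE eqxx/= ltnS leq_eqVlt; have [->|ji] := eqVneq j i.
    by rewrite eqxx/= ltnn mulr1 addr0.
  by rewrite mulr0 add0r -val_eqE/= in ji *; rewrite (negbTE ji).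
have -> : \sum_(j < n | (j < k.+1)%N) `|w ord0 j| = `|a| + \sum_(j < n | (j < k)%N) `|w ord0 j|.
  rewrite (bigD1 i)//=; congr (_ + _); apply: eq_bigl => j.
  by rewrite ltnS leq_eqVlt -val_eqE/=; case: ltngtP.
rewrite (_ : f _ - _ = (f (wk k.+1) - f (wk k)) + (f (wk k) - f 0)); last by ring.
rewrite mulrDr (le_trans (ler_normD _ _))// lerD ?IHk//; last exact: ltnW.
pose g (t : R) := f (t *: e i + wk k).
have inb (t : R) : `|t| <= rho -> forall j, `|(t *: e i + wk k) ord0 j| <= rho.
  move=> ta j; rewrite !mxE eqxx/=; have [->|ji] := eqVneq j i.
    by rewrite ltnn mulr1 addr0.
  by rewrite mulr0 add0r; case: ifP => _; [exact: Hw|rewrite normr0; exact: rho0 i].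
have Dg (t : R) : `|t| <= rho -> is_derive t 1 g ('D_(e i) f (t *: e i + wk k)).
  by move=> ta; apply: is_derive_lineV; split => //; case: (Hf i _ (inb t ta)).
have cg (t : R) : `|t| <= rho -> {for t, continuous g}.
  move=> ta; apply: differentiable_continuous; apply/derivable1_diffP.
  by case: (Dg t ta).
have -> : f (wk k) = g 0 by rewrite /g scale0r add0r.
rewrite wkS -/(g a).
have arho : `|a| <= rho by exact: Hw.
have [a0|a0|a0] := ltgtP 0 a; last by rewrite -a0 subrr normr0 mulr0.
- have itv t : 0 <= t -> t <= a -> `|t| <= rho.
    by move=> t0 ta; rewrite ger0_norm// (le_trans ta)// (le_trans (ler_norm _)).
  have [|| c] := @MVT R g (fun t => 'D_(e i) f (t *: e i + wk k)) 0 a a0.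
  + by move=> t /[!in_itv]/= /andP[t0 ta]; apply: Dg; apply: itv; exact: ltW.
  + by apply: continuous_in_subspaceT => t /[!inE]/= /[!in_itv]/= /andP[t0 ta]; apply: cg; exact: itv.
  + move=> /[!in_itv]/= /andP[c0 ca] ->; rewrite subr0 normrM ler_wpM2r//.
    by apply: (Hf _ _ _).2; apply: inb; apply: itv; exact: ltW.
- have itv t : a <= t -> t <= 0 -> `|t| <= rho.
    by move=> ta t0; rewrite ler0_norm// (le_trans _ arho)// ltr0_norm// lerN2.
  have [|| c] := @MVT R g (fun t => 'D_(e i) f (t *: e i + wk k)) a 0 a0.
  + by move=> t /[!in_itv]/= /andP[t0 ta]; apply: Dg; apply: itv; exact: ltW.
  + by apply: continuous_in_subspaceT => t /[!inE]/= /[!in_itv]/= /andP[t0 ta]; apply: cg; exact: itv.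
  + move=> /[!in_itv]/= /andP[c0 ca] E; rewrite distrC E sub0r normrM normrN ler_wpM2r//.
    by apply: (Hf _ _ _).2; apply: inb; apply: itv; exact: ltW.
Qed.

Lemma abs_coord_le_enorm (w : 'rV[R]_n) j : `|w ord0 j| <= enorm w.
Proof.
rewrite -sqrtr_sqr ler_wsqrtr// (bigD1 j)//= lerDl sumr_ge0// => i _; exact: sqr_ge0.
Qed.

Lemma is_derive_translate (f : 'rV[R]_n -> R) (x v d : 'rV[R]_n) :
  derivable f (x + v) d -> is_derive v d (fun v => f (x + v)) ('D_d f (x + v)).
Proof.
move=> df; apply: is_derive_line.
have := @is_derive_lineV R _ f (x + v) d 0 ('D_d f (x + v)).
rewrite scale0r add0r => h.
rewrite (_ : (fun h => _) = (fun h : R => f (h *: d + (x + v)))); last by apply/funext => t; rewrite addrCA.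
by apply: h; split.
Qed.

Lemma is_derive_reflect (f : 'rV[R]_n -> R) (x v d : 'rV[R]_n) :
  derivable f (x - v) d -> is_derive v d (fun v => f (x - v)) (- 'D_d f (x - v)).
Proof.
move=> df; apply: is_derive_line.
have D1 : is_derive (- 0 : R) 1 (fun h : R => f (h *: d + (x - v))) ('D_d f (x - v)).
  by rewrite oppr0; apply: is_derive_lineV; rewrite scale0r add0r; split.
have D2 : is_derive (0 : R) 1 (-%R : R -> R) (- 1) by exact: is_deriveNid.
have := is_derive1_comp D1 D2; rewrite mulrN1.
congr (is_derive _ _ _ _); apply/funext => t /=.
by rewrite opprD scaleNr addrCA.
Qed.

Lemma second_difference_bound (u : 'rV[R]_n -> R) : schwartz u ->
  exists2 K : R, 0 <= K & forall x w : 'rV[R]_n, `|u (x + w) + u (x - w) - 2 * u x| <= K * Num.min 1 (normsq w).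
Proof.
move=> hu.
have [B0 HB0] := schwartz_bounded hu [::].
have /choice[B2 HB2] (p : 'I_n * 'I_n) : exists M : R, forall x, `|iter_partial [:: p.1; p.2] u x| <= M.
  exact: schwartz_bounded.
pose C2 := \sum_p `|B2 p|.
have HC2 i j x : `|'D_(e i) (fun y => 'D_(e j) u y) x| <= C2.
  apply: (le_trans (HB2 (i, j) x)); rewrite /C2 (bigD1 (i, j))//=.
  by rewrite (le_trans (ler_norm _))// lerDl sumr_ge0.
have C20 : 0 <= C2 by exact: sumr_ge0.
have B00 : 0 <= B0 by exact: le_trans (HB0 0).
have d1 j x : derivable u x (e j) by exact: (hu.1 [::]).2.
have d2 i j x : derivable (fun y => 'D_(e j) u y) x (e i) by exact: (hu.1 [:: j]).2.
(* [4 * B0] is the trivial bound. The rest comes from two uses of [partials_lipschitz]: the partials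
   of [h v = u (x + v) + u (x - v)] vanish at 0 and are bounded by [2 * C2 * n * rho], and
   integrating them costs another [n * rho]. *)
pose K := 4 * B0 + 2 * C2 * n%:R * n%:R.
have K0 : 0 <= K by rewrite addr_ge0 ?mulr_ge0.
have sumle (v : 'rV[R]_n) (rho : R) : (forall j, `|v ord0 j| <= rho) -> \sum_j `|v ord0 j| <= n%:R * rho.
  move=> Hv; apply: (le_trans (ler_sum _ (fun j _ => Hv j))).
  by rewrite sumr_const card_ord mulr_natl.
exists K => // x w.
rewrite minr_pMr// mulr1 le_min; apply/andP; split.
  have -> : K = B0 + B0 + 2 * B0 + 2 * C2 * n%:R * n%:R by rewrite /K; ring.
  apply: (le_trans (ler_normB _ _)); rewrite normrM ger0_norm//.
  apply: (@le_trans _ _ (B0 + B0 + 2 * B0)); last by rewrite lerDl mulr_ge0// mulr_ge0// mulr_ge0.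
  apply: lerD; last by rewrite ler_pM2l//; exact: HB0.
  by apply: (le_trans (ler_normD _ _)); rewrite lerD//; exact: HB0.
pose rho := enorm w.
have Hw j : `|w ord0 j| <= rho by exact: abs_coord_le_enorm.
have rho0 : 0 <= rho by exact: sqrtr_ge0.
pose h v := u (x + v) + u (x - v).
have -> : u (x + w) + u (x - w) - 2 * u x = h w - h 0.
  by rewrite /h addr0 subr0; ring.
have Dh i v : is_derive v (e i) h ('D_(e i) u (x + v) - 'D_(e i) u (x - v)).
  have := is_derive_translate (d1 i (x + v)); have := is_derive_reflect (d1 i (x - v)) => D1 D2.
  exact: is_deriveD.
have bnd i (v : 'rV[R]_n) : (forall j, `|v ord0 j| <= rho) -> `|'D_(e i) u (x + v) - 'D_(e i) u (x - v)| <= 2 * C2 * n%:R * rho.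
  move=> Hv; pose g := fun y => 'D_(e i) u (x + y).
  have lip (v' : 'rV[R]_n) : (forall j, `|v' ord0 j| <= rho) -> `|g v' - g 0| <= C2 * (n%:R * rho).
    move=> Hv'; apply: (le_trans (@partials_lipschitz g C2 rho v' _ Hv')).
      move=> j y _; have [dg eg] := is_derive_translate (d2 j i (x + y)).
      by split; [exact: dg|rewrite eg; exact: (HC2 j i)].
    by rewrite ler_wpM2l// sumle.
  rewrite (_ : _ - _ = (g v - g 0) - (g (- v) - g 0)); last by rewrite /g; ring.
  apply: (le_trans (ler_normB _ _)); rewrite (_ : 2 * _ * _ * _ = C2 * (n%:R * rho) + C2 * (n%:R * rho)); last by ring.
  by apply: lerD; apply: lip => // j; rewrite mxE normrN.
have := @partials_lipschitz h (2 * C2 * n%:R * rho) rho w _ Hw => H.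
apply: (le_trans (H _)).
  by move=> i v Hv; have [dh eh] := Dh i v; split => //; rewrite eh; exact: bnd.
apply: (@le_trans _ _ (2 * C2 * n%:R * rho * (n%:R * rho))).
  by rewrite ler_wpM2l ?sumle// !mulr_ge0.
rewrite -enorm_sqr -/rho (_ : _ * (n%:R * rho) = 2 * C2 * n%:R * n%:R * rho ^+ 2); last by ring.
rewrite (_ : K * _ = 4 * B0 * rho ^+ 2 + 2 * C2 * n%:R * n%:R * rho ^+ 2); last by rewrite /K; ring.
by rewrite lerDr mulr_ge0 ?sqr_ge0// mulr_ge0.
Qed.

End second_difference.

(** * The boundary limit of the weighted normal derivative *)

Section flux_limit.
Context {R : realType} {n : nat}.
Variable s : R.
Hypotheses (s0 : 0 < s) (s1 : s < 1).
Variable u : 'rV[R]_n -> R.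
Hypothesis hu : schwartz u.
Variable x : 'rV[R]_n.
Local Notation V := ('rV[R]_n * R)%type.
Local Notation T := (n.-tuple (measurableTypeR R)).
Local Notation row t := (\row_i tnth t i).
Local Notation mu := (lebesgue_tuple R n).
Let m : R := n%:R / 2 + s.
Let C : R := Gamma m / (pi `^ (n%:R / 2) * Gamma s).
Let m0 : 0 < m. Proof. by rewrite ltr_wpDl// divr_ge0. Qed.
Let C0 : 0 < C. Proof. exact: poisson_constant_gt0. Qed.
Let cu := schwartz_continuous hu.
Let iu := schwartz_integrable hu.

(* [pflux s None] as a function of w, in a form which is meaningful at y = 0. *)
Definition kflux (y : R) (w : 'rV[R]_n) : R :=
  C * (2 * s) * (y ^+ 2 + normsq w) `^ (- m) - C * (2 * m) * (y ^+ 2 * (y ^+ 2 + normsq w) `^ (- (m + 1))).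

Let D (w : 'rV[R]_n) : R := u (x + w) + u (x - w) - 2 * u x.

Lemma pflux_kflux w y : pflux s None (w, y) = kflux y w.
Proof. by rewrite /pflux /kflux /rp /rr/= expr2 -/C -/m mul1r. Qed.

Lemma measurable_kflux y : measurable_fun setT (fun t : T => kflux y (row t)).
Proof.
apply: measurable_funB; apply: measurable_funM => //; first exact: measurable_bessel.
by apply: measurable_funM => //; exact: measurable_bessel.
Qed.

Let int1 y : 0 < y -> mu.-integrable setT (fun t : T => ((y ^+ 2 + normsq (row t)) `^ (- m))%:E).
Proof. by move=> y0; apply: bessel_integrable => //; rewrite exprn_gt0. Qed.

Let int2 y : 0 < y -> mu.-integrable setT (fun t : T => ((y ^+ 2 + normsq (row t)) `^ (- (m + 1)))%:E).
Proof.
move=> y0; rewrite /m -addrA; apply: bessel_integrable; first by rewrite addr_gt0.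
by rewrite exprn_gt0.
Qed.

Lemma kflux_integrable y : 0 < y -> mu.-integrable setT (fun t : T => (kflux y (row t))%:E).
Proof.
move=> y0; have := integrableB measurableT (integrableZl measurableT (C * (2 * s)) (int1 y0))
  (integrableZl measurableT (C * (2 * m) * y ^+ 2) (int2 y0)).
apply: eq_integrable => // t _; rewrite /= -!EFinM -EFinB /kflux.
by congr EFin; ring.
Qed.

(** It reflects that the mass of the Poisson kernel is independent of [y]. Concretely, the Gamma
    recurrence makes the second integral [s / m] times the first, up to [y^2], and
    [2 s - 2 m (s / m) = 0]. *)
Lemma integral_kflux y : 0 < y -> \int[mu]_t kflux y (row t) = 0.
Proof.
move=> y0; have y20 : 0 < y ^+ 2 by rewrite exprn_gt0.
rewrite /kflux RintegralB//; last 2 first.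
- exact: (integrableZl measurableT (C * (2 * s)) (int1 y0)).
- have := integrableZl measurableT (C * (2 * m) * y ^+ 2) (int2 y0).
  by apply: eq_integrable => // t _; rewrite /= -EFinM; congr EFin; ring.
under [X in _ - X]eq_Rintegral do rewrite mulrA.
rewrite !RintegralZl//; [|exact: int2|exact: int1].
have -> : \int[mu]_t (y ^+ 2 + normsq (row t)) `^ (- m) =
    pi `^ (n%:R / 2) * Gamma s / Gamma m * (y ^+ 2) `^ (- s).
  by rewrite /Rintegral bessel_integral.
have -> : \int[mu]_t (y ^+ 2 + normsq (row t)) `^ (- (m + 1)) =
    pi `^ (n%:R / 2) * (s * Gamma s) / (m * Gamma m) * ((y ^+ 2) `^ (- s) / y ^+ 2).
  rewrite /Rintegral /m -(addrA _ s 1) bessel_integral ?addr_gt0//= addrA -/m !Gamma_succ//.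
  by rewrite opprD powR_add// powR_inv1 ?ltW.
rewrite /C; field.
by rewrite ?gt_eqF ?mulr_gt0 ?Gamma_gt0 ?powR_gt0 ?pi_gt0 ?m0.
Qed.

Lemma kflux_mul_integrable (v : 'rV[R]_n -> R) (M y : R) : continuous v -> (forall z, `|v z| <= M) -> 0 < y ->
  mu.-integrable setT (EFin \o (fun t : T => kflux y (row t) * v (row t))).
Proof.
move=> cv bv y0.
apply: le_integrable (integrableZl measurableT M (kflux_integrable y0)) => //.
  apply/measurable_EFinP; apply: measurable_funM; first exact: measurable_kflux.
  exact: measurable_tuple_continuous.
move=> t _; rewrite -EFinM lee_fin !normrM [leLHS]mulrC ler_wpM2r//.
by rewrite (le_trans (bv _))// ler_norm.
Qed.

Lemma continuous_affine (c : R) : continuous (fun w : 'rV[R]_n => u (x + c *: w)).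
Proof.
move=> z; have h : {for z, continuous (fun w : 'rV[R]_n => x + c *: w)}.
  apply: (@continuousD _ _ _ (cst x) _ z); first exact: cst_continuous.
  exact: scaler_continuous.
exact: (continuous_comp h (@cu _)).
Qed.

Lemma flux_poisson_ext y : 0 < y ->
  y `^ (1 - 2 * s) * partial None (poisson_ext s u) (x, y) =
  2^-1 * \int[mu]_t (kflux y (row t) * D (row t)).
Proof.
move=> y0; have [M HM] := schwartz_bounded hu [::].
have p0 : 0 < (x, y).2 by [].
have ctr (c : R) : continuous (fun w : 'rV[R]_n => u (x + c *: w)) by exact: continuous_affine.
have bu c z : `|u (x + c *: z)| <= M by exact: HM.
rewrite partial_poisson_ext// -[X in X `^ _]/(x, y).2 ktransZ//; last first.
  exact: ((good_pker s0 1).2 None).2.1.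
rewrite (@ktrans_ext _ _ _ _ (pflux s None))//; last by move=> q q0; rewrite /= pfluxE.
have gp : good0 (pflux (n := n) s None).
  apply: (@good_ext _ _ 0 (yp (1 - 2 * s) \* partial None (pker s)) _ _ _).1 => [q q0|].
    by rewrite /= pfluxE.
  have [gy _ _] := @good_basic R n 0.
  by apply: goodM => //; exact: ((good_pker s0 1).2 None).2.
(* Used for [c = 1] and [c = -1]: the kernel is even, so both substitutions represent the same flux,
   and their mean produces the factor 1/2. *)
have kE (c : R) : c ^+ 2 = 1 -> ktrans u (pflux s None) (x, y) = \int[mu]_t (kflux y (row t) * u (x + c *: row t)).
  move=> c1; have c0 : c != 0 by apply: contra_eq_neq c1 => ->; rewrite expr0n/= eq_sym oner_eq0.
  rewrite /ktrans /convolution (@integral_Rn_affine _ _ (fun z => pflux s None (x - z, y) * u z) x c c0).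
    have -> : `|c| = 1 by apply/eqP; rewrite -(@eqrXn2 _ 2%N)// -normrX c1 normr1 expr1n.
    rewrite expr1n mul1r; apply: eq_Rintegral => t _.
    rewrite pflux_kflux; congr (_ * _); rewrite /kflux.
    suff -> : normsq (x - (x + c *: row t)) = normsq (row t) by [].
    rewrite opprD addNKr; apply: eq_bigr => i _.
    by rewrite mxE [X in (- X) ^+ 2]mxE sqrrN exprMn c1 mul1r.
  exact: (ker_integrable cu iu gp p0).
have i1 : mu.-integrable setT (EFin \o (fun t : T => kflux y (row t) * u (x + 1 *: row t))).
  exact: (kflux_mul_integrable (ctr 1) (bu 1) y0).
have i2 : mu.-integrable setT (EFin \o (fun t : T => kflux y (row t) * u (x + (-1) *: row t))).
  exact: (kflux_mul_integrable (ctr (-1)) (bu (-1)) y0).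
have i3 : mu.-integrable setT (EFin \o (fun t : T => 2 * u x * kflux y (row t))).
  exact: (integrableZl measurableT (2 * u x) (kflux_integrable y0)).
have -> : \int[mu]_t (kflux y (row t) * D (row t)) =
   \int[mu]_t (kflux y (row t) * u (x + 1 *: row t)) + \int[mu]_t (kflux y (row t) * u (x + (-1) *: row t))
   - \int[mu]_t (2 * u x * kflux y (row t)).
  rewrite -RintegralD// -RintegralB//; last first.
    have := integrableD measurableT i1 i2; apply: eq_integrable => //.
  by apply: eq_Rintegral => t _; rewrite /D scale1r scaleN1r; ring.
rewrite RintegralZl//; last exact: kflux_integrable.
rewrite integral_kflux// mulr0 subr0 -(kE 1) ?expr1n// -(kE (-1)) ?sqrrN ?expr1n//.
by field.
Qed.

Let contD : continuous D.
Proof.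
have -> : D = (fun w => u (x + 1 *: w) + u (x + (-1) *: w) - 2 * u x).
  by apply/funext => w; rewrite scale1r scaleN1r.
move=> w.
have h1 := @continuous_affine 1 w; have h2 := @continuous_affine (-1) w.
have h3 : {for w, continuous (fun=> 2 * u x)} by exact: cst_continuous.
exact: (@cvgB R R^o _ _ _ _ _ _ _ (@cvgD R R^o _ _ _ _ _ _ _ h1 h2) h3).
Qed.

(** At the origin the kernel may blow up as [y] tends to 0, while [kflux 0] takes a default value of
    the power there; the vanishing of [D] settles both the bound and the continuity in [y] at that
    point. *)
Let D0 w : normsq w <= 0 -> D w = 0.
Proof.
have [K K0 HK] := second_difference_bound hu.
move=> w0; apply/eqP; rewrite -normr_le0; apply: le_trans (HK x w) _.
have -> : normsq w = 0 by apply/eqP; rewrite eq_le w0 normsq_ge0.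
by rewrite min_r ?mulr0.
Qed.

(** The bound is uniform in [y]: the factor [y^2] is absorbed by one power of [y^2 + |w|^2], and
    what remains is at most [|w|^(- 2 m)]. The majorant is the function of [riesz_integrable]. *)
Lemma kflux_bound : exists K : R, forall y (t : T),
  `|kflux y (row t) * D (row t)| <= K * (Num.min 1 (normsq (row t)) / normsq (row t) `^ m).
Proof.
have [K K0 HK] := second_difference_bound hu.
have Cs : 0 <= C * (2 * s) by rewrite ltW// mulr_gt0// mulr_gt0.
have Cm : 0 <= C * (2 * m) by rewrite ltW// mulr_gt0// mulr_gt0.
have K'0 : 0 <= (C * (2 * s) + C * (2 * m)) * K by rewrite mulr_ge0// addr_ge0.
exists ((C * (2 * s) + C * (2 * m)) * K) => y t.
set q := normsq (row t); have q0 : 0 <= q by exact: normsq_ge0.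
have [q1|q1] := leP q 0.
  by rewrite (D0 q1) mulr0 normr0 mulr_ge0// divr_ge0 ?powR_ge0// le_min ler01.
have r0 : 0 < y ^+ 2 + q by rewrite ltr_wpDl// sqr_ge0.
have h1 : (y ^+ 2 + q) `^ (- m) <= (q `^ m)^-1.
  rewrite powRN lef_pV2 ?posrE ?powR_gt0//; apply: ge0_ler_powR; rewrite ?nnegrE ?(ltW m0) ?(ltW r0)//.
  by rewrite lerDr sqr_ge0.
have h2 : y ^+ 2 * (y ^+ 2 + q) `^ (- (m + 1)) <= (q `^ m)^-1.
  apply: le_trans h1; rewrite opprD powR_add// powR_inv1 ?(ltW r0)// mulrCA ler_piMr ?powR_ge0//.
  by rewrite ler_pdivrMr// mul1r lerDl.
have hk : `|kflux y (row t)| <= (C * (2 * s) + C * (2 * m)) * (q `^ m)^-1.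
  rewrite /kflux -/q (le_trans (ler_normB _ _))// (mulrDl (C * (2 * s))) lerD//.
  - by rewrite normrM (ger0_norm Cs) (ger0_norm (powR_ge0 _ _)) ler_wpM2l.
  - by rewrite normrM (ger0_norm Cm) (ger0_norm (mulr_ge0 (sqr_ge0 _) (powR_ge0 _ _))) ler_wpM2l.
rewrite normrM; apply: le_trans (ler_pM _ _ hk (HK x (row t))) _ => //.
by rewrite -/q le_eqVlt; apply/orP; left; apply/eqP; ring.
Qed.

Lemma flux_limit :
  y `^ (1 - 2 * s) * partial None (poisson_ext s u) (x, y) @[y --> 0^'+] -->
  2^-1 * \int[mu]_t (kflux 0 (row t) * D (row t)).
Proof.
have [K' bnd] := kflux_bound.
pose Phi (y : R) := \int[mu]_t (kflux y (row t) * D (row t)).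
(* [kflux] depends on [y] through [y^2] only, so [Phi] is dominated for every real [y] and the
   one-sided limit becomes continuity at 0. *)
have cPhi : {for (0 : R), continuous Phi}.
  apply: (@continuous_param_Rintegral _ _ _ _ _ (fun (y : R) (t : T) => kflux y (row t) * D (row t)) 0
     (fun t => K' * (Num.min 1 (normsq (row t)) / normsq (row t) `^ m))).
  - exact: (integrableZl measurableT K' (riesz_integrable _ s0 s1)).
  - near=> y; apply: measurable_funM; first exact: measurable_kflux.
    exact: measurable_tuple_continuous contD.
  - by near=> y => t; exact: bnd.
  - move=> t; have [q1|q1] := leP (normsq (row t)) 0.
      rewrite (_ : (fun _ => _) = cst 0); first exact: cst_continuous.
      by apply/funext => y; rewrite (D0 q1) mulr0.
    apply: cvgM; last exact: cvg_cst.
    have pc (b : R) : {for (0 : R), continuous (fun y : R => (y ^+ 2 + normsq (row t)) `^ b)}.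
      apply: (@continuous_comp _ _ _ (fun y : R => y ^+ 2 + normsq (row t)) (fun z => z `^ b) 0).
        by apply: cvgD; [exact: exprn_continuous|exact: cvg_cst].
      by apply: powR_continuous_at; rewrite expr0n/= add0r.
    apply: cvgB; apply: cvgM; try exact: cvg_cst; first exact: pc.
    by apply: cvgM; [exact: exprn_continuous|exact: pc].
have : 2^-1 * Phi y @[y --> 0^'+] --> 2^-1 * Phi 0.
  by apply: cvgMr; apply: cvg_at_right_filter; exact: cPhi.
apply: cvg_trans; apply: near_eq_cvg; near=> y.
rewrite flux_poisson_ext//; near: y; exact: nbhs_right_gt.
Unshelve. all: by end_near. Qed.

(** At [y = 0] only the term with coefficient [2 C s] survives; the factor 1/2 turns it into [C s],
    and the sign appears because [D] is the opposite of the numerator in the fractional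
    Laplacian. *)
Lemma flux_limitE :
  2^-1 * \int[mu]_t (kflux 0 (row t) * D (row t)) =
  - (C * s) * integral_Rn (fun z => (2 * u x - u (x + z) - u (x - z)) / enorm z `^ (n%:R + 2 * s)).
Proof.
have [K HK] := kflux_bound.
have cs : C * s * 2 != 0 by rewrite lt0r_neq0// mulr_gt0// mulr_gt0.
have E (w : 'rV[R]_n) : (2 * u x - u (x + w) - u (x - w)) / enorm w `^ (n%:R + 2 * s) =
    - (C * s * 2)^-1 * (kflux 0 w * D w).
  have -> : enorm w `^ (n%:R + 2 * s) = normsq w `^ m.
    by rewrite -enorm_powR; congr (_ `^ _); rewrite /m; field.
  by rewrite /kflux expr0n/= mul0r mulr0 subr0 add0r powRN /D; set r := (_ `^ _)^-1; field; rewrite (lt0r_neq0 C0) (lt0r_neq0 s0).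
have i0 : mu.-integrable setT (EFin \o (fun t : T => kflux 0 (row t) * D (row t))).
  apply: le_integrable (integrableZl measurableT K (riesz_integrable _ s0 s1)) => //.
    apply/measurable_EFinP; apply: measurable_funM; first exact: measurable_kflux.
    exact: measurable_tuple_continuous contD.
  move=> t _; rewrite lee_fin; apply: le_trans (HK 0 t) _; exact: ler_norm.
have -> : integral_Rn (fun z => (2 * u x - u (x + z) - u (x - z)) / enorm z `^ (n%:R + 2 * s)) =
    \int[mu]_t (- (C * s * 2)^-1 * (kflux 0 (row t) * D (row t))).
  by apply: eq_Rintegral => t _; exact: E.
rewrite RintegralZl//; field.
by rewrite (lt0r_neq0 C0) (lt0r_neq0 s0).
Qed.

End flux_limit.

(** * Uniqueness *)

Section second_derivative_test.
Context {R : realType}.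

(** If [L > 0], then [f1] is positive just to the right of its zero at 0, and the mean value theorem
    yields a value of [f] above [f 0]. *)
Lemma second_derivative_test_line (f f1 : R -> R) (L : R) :
  (\forall t \near (0 : R), is_derive t (1 : R) f (f1 t)) -> is_derive (0 : R) (1 : R) f1 L ->
  (\forall t \near (0 : R), f t <= f 0) -> f1 0 = 0 /\ L <= 0.
Proof.
move=> df [df1 dL] fmax.
have f10 : f1 0 = 0.
  have [d /= d0 Hd] := (nbhs_ballP _ _).1 (filterI df fmax).
  have H t : t \in `](- d), d[ -> is_derive t 1 f (f1 t) /\ f t <= f 0.
    by rewrite in_itv/= => /andP[h1 h2]; apply: Hd; rewrite /ball/= sub0r normrN ltr_norml h1.
  have z : 0 \in `](- d), d[ by rewrite in_itv/= oppr_lt0 d0.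
  have dd : - d <= d by rewrite (le_trans _ (ltW d0))// oppr_le0 ltW.
  have [_ <-] := (H 0 z).1.
  have [||_ //] := @derive1_at_max R f (- d) d 0 dd _ z.
  + by move=> t /H[[]].
  + by move=> t /H[].
split => //; rewrite leNgt; apply/negP => L0.
have cv : h^-1 *: ((f1 \o shift 0) (h *: 1) - f1 0) @[h --> 0^'] --> L by rewrite -dL.
have [d /= d0 Hd] := (nbhs_ballP _ _).1 (filterI df (filterI fmax (cvgr_gt _ cv _ L0))).
have b t : 0 <= t -> t < d -> ball (0 : R) d t by move=> t0 td; rewrite /ball/= sub0r normrN ger0_norm.
pose e := d / 2.
have e0 : 0 < e by rewrite divr_gt0.
have ed : e < d by rewrite /e; lra.
have [||c] := @MVT R f f1 0 e e0.
- by move=> t /[!in_itv]/= /andP[t0 te]; apply: (Hd t (b _ _ _)).1; lra.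
- apply: continuous_in_subspaceT => t /[!inE]/= /[!in_itv]/= /andP[t0 te].
  apply: differentiable_continuous; apply/derivable1_diffP.
  by case: (Hd t (b t t0 (le_lt_trans te ed))).1.
rewrite in_itv/= => /andP[c0 ce].
have [_ [_ H]] := Hd c (b _ (ltW c0) (lt_trans ce ed)).
have {}H : 0 < f1 c.
  have := H (lt0r_neq0 c0); rewrite /= f10 subr0 addr0 [c%:A]mulr1 /GRing.scale/=.
  by rewrite pmulr_rgt0 ?invr_gt0.
move=> /eqP; rewrite subr0; apply/negP; rewrite lt_eqF//.
apply: (@le_lt_trans _ _ 0); last by rewrite mulr_gt0.
rewrite subr_le0; exact: (Hd e (b _ (ltW e0) ed)).2.1.
Qed.

Lemma second_derivative_test (V : normedModType R) (F F1 : V -> R) (c v : V) (L : R) :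
  (\forall q \near c, is_derive q v F (F1 q)) -> is_derive c v F1 L ->
  (\forall q \near c, F q <= F c) -> F1 c = 0 /\ L <= 0.
Proof.
move=> dF dF1 Fmax.
have cl : {for (0 : R), continuous (fun t : R => t *: v + c)}.
  apply: (@continuousD _ _ _ (fun t : R => t *: v) (cst c) 0); last exact: cst_continuous.
  exact: scalel_continuous.
have E : 0 *: v + c = c by rewrite scale0r add0r.
have near0 (P : set V) : (\forall q \near c, P q) -> \forall t \near (0 : R), P (t *: v + c).
  by move=> Pc; apply: cl; rewrite E.
have := @second_derivative_test_line (fun t => F (t *: v + c)) (fun t => F1 (t *: v + c)) L.
rewrite !E; apply.
- by apply: filterS (near0 _ dF) => t dt; exact: is_derive_lineV.
- by apply: is_derive_lineV; rewrite E.
- by have := near0 _ Fmax.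
Qed.

End second_derivative_test.

(** * Comparison of two bounded solutions on a half cube *)

Section uniqueness.
Context {R : realType} {n : nat}.
Local Notation V := ('rV[R]_n * R)%type.
Variable s : R.
Hypotheses (s0 : 0 < s) (s1 : s < 1).

(** The nondivergence form, to which the second derivative test applies; the factor [y ^ a] is
    positive, so both forms vanish together. *)
Lemma weighted_divergenceE (a : R) (U : V -> R) (p : V) : C2_upper_half_space U -> 0 < p.2 ->
  weighted_divergence a U p =
  p.2 `^ a * (\sum_k partial k (partial k U) p + a / p.2 * partial None U p).
Proof.
move=> HU p0; have [_ dU] := HU _ p0.
have D k : partial k (fun q => q.2 `^ a * partial k U q) p =
   p.2 `^ a * (partial k (partial k U) p + (k == None)%:R * (a / p.2 * partial None U p)).
  have D1 := is_derive_yp a k p0.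
  have D2 : is_derive p (direction k) (partial k U) (partial k (partial k U) p).
    by have [_ _ /(_ k)[]] := dU k; split.
  have : is_derive p (direction k) (yp a * partial k U)
      (p.2 `^ a * (partial k (partial k U) p + (k == None)%:R * (a / p.2 * partial None U p))).
    apply: is_derive_eq; rewrite /GRing.scale/= /yp powR_add// powR_inv1 ?ltW//.
    by case: k {D1 D2} => [i|] /=; ring.
  by case.
rewrite /weighted_divergence (eq_bigr _ (fun k _ => D k)) -mulr_sumr big_split/=.
congr (_ * (_ + _)); rewrite (bigD1 None)//= mul1r big1 ?addr0// => k /negbTE ->.
by rewrite mul0r.
Qed.

Lemma is_derive_combination (W : normedModType R) (f g h : W -> R) (c v : W) (b0 b1 b2 b3 df dg dh : R) :
  is_derive c v f df -> is_derive c v g dg -> is_derive c v h dh ->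
  is_derive c v (fun q => b0 + b1 * f q + b2 * g q + b3 * h q) (b1 * df + b2 * dg + b3 * dh).
Proof.
move=> Df Dg Dh.
have := is_deriveD (is_deriveD (is_deriveD (is_derive_cst b0 c v) (is_deriveZ b1 Df)) (is_deriveZ b2 Dg)) (is_deriveZ b3 Dh).
by rewrite add0r.
Qed.

(* For a = 1 - 2 s, the operator sum_k d_kk + (a / y) d_y annihilates y^(2 s) and is
   constant on the other terms of the barrier. *)
Definition barrier (b0 b1 b2 b3 : R) (q : V) : R :=
  b0 + b1 * rr q + b2 * (hcoord None * hcoord None) q + b3 * yp (2 * s) q.

(** Written in the shape of [is_derive_combination], zero constant included, so that the same lemma
    differentiates it once more. *)
Definition barrier_partial (b1 b2 b3 : R) (k : option 'I_n) (q : V) : R :=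
  0 + 2 * b1 * hcoord k q + (k == None)%:R * (2 * b2) * hcoord None q +
  (k == None)%:R * (b3 * (2 * s)) * yp (2 * s - 1) q.

Lemma is_derive_rr k (p : V) : is_derive p (direction k) (@rr R n) (2 * hcoord k p).
Proof.
apply: is_derive_line.
rewrite (_ : (fun h => _) = (fun h : R => (rr p + 2 * hcoord k p * h + h ^+ 2))); last first.
  by apply/funext => h; rewrite rr_line.
by apply: is_derive_eq; rewrite /GRing.scale/=; ring.
Qed.

Lemma is_derive_barrier (b0 b1 b2 b3 : R) k (p : V) : 0 < p.2 ->
  is_derive p (direction k) (barrier b0 b1 b2 b3) (barrier_partial b1 b2 b3 k p).
Proof.
move=> p0; have D2 := is_derive_hcoord None k p.
have D3 := is_derive_yp (2 * s) k p0.
have := is_derive_combination b0 b1 b2 b3 (is_derive_rr k p) (is_deriveM D2 D2) D3.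
rewrite /barrier_partial /GRing.scale/= eq_sym => h; apply: is_derive_eq h _.
by rewrite -?[hcoord None p]/p.2; ring.
Qed.

Lemma is_derive_barrier_partial (b1 b2 b3 : R) k (p : V) : 0 < p.2 ->
  is_derive p (direction k) (barrier_partial b1 b2 b3 k)
   (2 * b1 + (k == None)%:R * (2 * b2 + b3 * (2 * s) * ((2 * s - 1) * p.2 `^ (2 * s - 1 - 1)))).
Proof.
move=> p0.
have := is_derive_combination 0 (2 * b1) ((k == None)%:R * (2 * b2)) ((k == None)%:R * (b3 * (2 * s)))
  (is_derive_hcoord k k p) (is_derive_hcoord None k p) (is_derive_yp (2 * s - 1) k p0).
rewrite eqxx => h; apply: is_derive_eq h _; rewrite /yp.
by case: k => [i|] /=; ring.
Qed.

(** The scalar identity at a critical point: [S1], [S2] are the sums of pure second derivatives of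
    the two solutions, [P1], [P2] their y-derivatives, [Y] is [y ^ (2 s - 1)]. The equations and the
    critical point condition eliminate the solutions, and [b3] drops out because [y ^ (2 s)] is
    itself a solution. *)
Lemma barrier_operator (S1 S2 P1 P2 y Y b1 b2 b3 : R) : 0 < y ->
  S1 + (1 - 2 * s) / y * P1 = 0 -> S2 + (1 - 2 * s) / y * P2 = 0 ->
  P1 - P2 + (0 + 2 * b1 * y + 1 * (2 * b2) * y + 1 * (b3 * (2 * s)) * Y) = 0 ->
  S1 - S2 + (2 * b1 *+ n.+1 + (2 * b2 + b3 * (2 * s) * ((2 * s - 1) * (Y / y)))) =
  2 * (b1 * (n%:R + 2 - 2 * s) + b2 * (2 - 2 * s)).
Proof.
move=> y0 /eqP; rewrite addr_eq0 => /eqP ->; move=> /eqP; rewrite addr_eq0 => /eqP ->.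
move=> /eqP; rewrite addr_eq0 subr_eq => /eqP ->.
by rewrite -mulr_natr -natr1; field; rewrite lt0r_neq0.
Qed.

(** At an interior maximum the sum of pure second derivatives is at most 0, but [barrier_operator]
    evaluates it to twice the quantity assumed positive. *)
Lemma barrier_no_max (U1 U2 : V -> R) (b0 b1 b2 b3 : R) (c : V) :
  C2_upper_half_space U1 -> C2_upper_half_space U2 ->
  (forall p, 0 < p.2 -> weighted_divergence (1 - 2 * s) U1 p = 0) ->
  (forall p, 0 < p.2 -> weighted_divergence (1 - 2 * s) U2 p = 0) ->
  0 < b1 * (n%:R + 2 - 2 * s) + b2 * (2 - 2 * s) -> 0 < c.2 ->
  ~ (\forall q \near c, U1 q - U2 q + barrier b0 b1 b2 b3 q <= U1 c - U2 c + barrier b0 b1 b2 b3 c).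
Proof.
move=> C1 C2 L1 L2 bpos c0 cmax.
have T k : partial k U1 c - partial k U2 c + barrier_partial b1 b2 b3 k c = 0 /\
    partial k (partial k U1) c - partial k (partial k U2) c +
   (2 * b1 + (k == None)%:R * (2 * b2 + b3 * (2 * s) * ((2 * s - 1) * c.2 `^ (2 * s - 1 - 1)))) <= 0.
  have dF : \forall q \near c, is_derive q (direction k) (U1 - U2 + barrier b0 b1 b2 b3)
      (partial k U1 q - partial k U2 q + barrier_partial b1 b2 b3 k q).
    near=> q; have q0 : 0 < q.2 by near: q; exact: near_half_space.
    have D1 : is_derive q (direction k) U1 (partial k U1 q).
      by have [_ /(_ k)[]] := C1 _ q0; split.
    have D2 : is_derive q (direction k) U2 (partial k U2 q).
      by have [_ /(_ k)[]] := C2 _ q0; split.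
    exact: (is_deriveD (is_deriveB D1 D2) (is_derive_barrier b0 b1 b2 b3 k q0)).
  have D1 : is_derive c (direction k) (partial k U1) (partial k (partial k U1) c).
    by have [_ /(_ k)[_ _ /(_ k)[]]] := C1 _ c0; split.
  have D2 : is_derive c (direction k) (partial k U2) (partial k (partial k U2) c).
    by have [_ /(_ k)[_ _ /(_ k)[]]] := C2 _ c0; split.
  exact: (second_derivative_test dF (is_deriveD (is_deriveB D1 D2) (is_derive_barrier_partial b1 b2 b3 k c0)) cmax).
have pa : c.2 `^ (1 - 2 * s) != 0 by rewrite lt0r_neq0// powR_gt0.
have := L1 _ c0; rewrite weighted_divergenceE// => /eqP; rewrite mulf_eq0 (negbTE pa)/= => /eqP E1.
have := L2 _ c0; rewrite weighted_divergenceE// => /eqP; rewrite mulf_eq0 (negbTE pa)/= => /eqP E2.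
have : \sum_k (partial k (partial k U1) c - partial k (partial k U2) c +
   (2 * b1 + (k == None)%:R * (2 * b2 + b3 * (2 * s) * ((2 * s - 1) * c.2 `^ (2 * s - 1 - 1))))) <= 0.
  by apply: sumr_le0 => k _; exact: (T k).2.
rewrite big_split/= sumrB big_split/= sumr_const card_option card_ord.
have -> (Z : R) : \sum_(k : option 'I_n) (k == None)%:R * Z = Z.
  by rewrite (bigD1 None)//= mul1r big1 ?addr0// => k /negbTE ->; rewrite mul0r.
have := (T None).1; rewrite /barrier_partial/= /yp.
rewrite (@powR_add _ c.2 (2 * s - 1) (-1) c0) powR_inv1 ?(ltW c0)// => e H.
have : 2 * (b1 * (n%:R + 2 - 2 * s) + b2 * (2 - 2 * s)) <= 0.
  apply: le_trans H; rewrite le_eqVlt; apply/orP; left; apply/eqP; symmetry.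
  exact: (barrier_operator c0 E1 E2 e).
by rewrite leNgt mulr_gt0.
Unshelve. all: by end_near. Qed.

(* The norm is there because y `^ b = 1 for y < 0. *)
Lemma powR_norm_continuous (b : R) : 0 < b -> continuous (fun y : R => `|y| `^ b).
Proof.
move=> b0 y; have [->|y0] := eqVneq y 0; last first.
  apply: (@continuous_comp R R R (fun z : R => `|z|) (fun z : R => z `^ b) y); first exact: norm_continuous.
  by apply: powR_continuous_at; rewrite normr_gt0.
rewrite /continuous_at normr0 powR0 ?lt0r_neq0//.
apply/cvgrPdist_lt => e e0.
have h := @powR_cvg0 R b b0.
have /cvgrPdist_lt/(_ e e0) := h.
move=> /nbhs_ballP[d /= d0 Hd]; apply/nbhs_ballP; exists d => //= z zd.
have [->|z0] := eqVneq z 0; first by rewrite normr0 powR0 ?lt0r_neq0// subrr normr0.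
apply: Hd; last by rewrite normr_gt0.
by move: zd; rewrite /ball/= !sub0r !normrN normr_id.
Qed.

Lemma norm_le_enorm (x : 'rV[R]_n) : `|x| <= enorm x.
Proof.
rewrite /Num.norm/=; have [->|/mx_norm_neq0[[i j] ->]] := eqVneq (mx_norm x) 0; first exact: sqrtr_ge0.
by rewrite /= ord1; exact: abs_coord_le_enorm.
Qed.

(** The norm is the sup norm; on the lateral faces the Euclidean norm is still at least [rho], by
    [norm_le_enorm]. *)
Definition half_cube (rho : R) : set V := [set x : 'rV[R]_n | `|x| <= rho] `*` `[0, rho]%classic.

Lemma half_cube_compact rho : compact (half_cube rho).
Proof.
apply: compact_setX; last exact: segment_compact.
apply: bounded_closed_compact.
  by exists rho; split; [exact: num_real|move=> M rM x /= /le_trans; apply; exact: ltW].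
apply: (closed_comp (f := fun x : 'rV[R]_n => `|x|) (D := [set r : R | r <= rho])); last exact: closed_le.
by move=> x _; exact: norm_continuous.
Qed.

Variable u : 'rV[R]_n -> R.
Variables V1 V2 : V -> R.
Hypotheses (sol1 : extension_solution (1 - 2 * s) u V1) (sol2 : extension_solution (1 - 2 * s) u V2).
Variable M : R.
Hypotheses (bV1 : forall x y, 0 <= y -> `|V1 (x, y)| <= M) (bV2 : forall x y, 0 <= y -> `|V2 (x, y)| <= M).
Let M2 := 2 * M.
Let k : R := n%:R / (2 - 2 * s).
Let s2 : 0 < 2 - 2 * s. Proof. by rewrite subr_gt0 -[ltRHS]mulr1 ltr_pM2l. Qed.
Let k0 : 0 <= k. Proof. by rewrite divr_ge0// ltW. Qed.
Let M20 : 0 <= M2.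
Proof. by rewrite mulr_ge0// (le_trans _ (bV1 0 (lexx 0))). Qed.
Let bW x y : 0 <= y -> V1 (x, y) - V2 (x, y) <= M2.
Proof.
move=> y0; apply: le_trans (ler_norm _) _; apply: le_trans (ler_normB _ _) _.
by rewrite /M2 (_ : 2 * M = M + M) ?lerD ?bV1 ?bV2//; ring.
Qed.

(* The comparison function of scale rho = 1 / r with opposite sign, minus
   r (1 - (r y)^2), which makes the operator strictly positive on it. *)
Let bar (r : R) := barrier (- r) (- (M2 * r ^+ 2)) (M2 * r ^+ 2 * (1 + k) + r ^+ 3) (- (M2 * (1 + k) * r `^ (2 * s))).

(** [rr] already contains [y^2], which is why [1 + k] in the [y^2] coefficient of [bar] becomes [k]
    here. *)
Let barE r (p : V) : 0 < r -> 0 <= p.2 -> bar r p =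
  - (r * (1 - (r * p.2) ^+ 2)) -
  M2 * (r ^+ 2 * normsq p.1 + (1 + k) * (r * p.2) `^ (2 * s) - k * (r * p.2) ^+ 2).
Proof.
move=> r0 p0; rewrite powRM ?(ltW r0)//.
rewrite -[LHS]/(- r + - (M2 * r ^+ 2) * (p.2 ^+ 2 + normsq p.1) + (M2 * r ^+ 2 * (1 + k) + r ^+ 3) * (p.2 * p.2)
  + - (M2 * (1 + k) * r `^ (2 * s)) * p.2 `^ (2 * s)).
ring.
Qed.

Lemma barrier_comparison r p : 0 < r -> half_cube r^-1 p -> V1 p - V2 p + bar r p <= 0.
Proof.
move=> r0 Kp.
have [C1 E1 W1 I1 _] := sol1; have [C2 E2 W2 I2 _] := sol2.
pose f (q : V) := V1 q - V2 q + bar r q.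
have KH : half_cube r^-1 `<=` [set p : V | 0 <= p.2].
  by move=> q [_ /=]; rewrite in_itv/= => /andP[].
have cf : {within half_cube r^-1, continuous f}.
  have c1 := continuous_subspaceW KH W1; have c2 := continuous_subspaceW KH W2.
  (* [bar] with [|y|] inside the power: continuous on the whole space and equal to [bar] on the half
     cube. *)
  pose g (q : V) : R := - r + - (M2 * r ^+ 2) * rr q + (M2 * r ^+ 2 * (1 + k) + r ^+ 3) * (q.2 * q.2)
     + - (M2 * (1 + k) * r `^ (2 * s)) * `|q.2| `^ (2 * s).
  have cg : {within half_cube r^-1, continuous g}.
    apply: continuous_subspaceT => q.
    have h1 : rr x @[x --> q] --> rr q := @rr_continuous R n q.
    have h2 : x.2 @[x --> q] --> q.2 by exact: cvg_snd.
    have h3 : `|x.2| `^ (2 * s) @[x --> q] --> `|q.2| `^ (2 * s).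
      apply: (@continuous_comp _ _ _ (snd : V -> R) (fun y : R => `|y| `^ (2 * s)) q); first exact: cvg_snd.
      by apply: powR_norm_continuous; rewrite mulr_gt0.
    apply: (@cvgD R R^o); [apply: (@cvgD R R^o); [apply: (@cvgD R R^o)|]|].
    - exact: cvg_cst.
    - by apply: cvgM => //; exact: cvg_cst.
    - by apply: cvgM; [exact: cvg_cst|exact: cvgM].
    - by apply: cvgM => //; exact: cvg_cst.
  apply: (@subspace_eq_continuous _ _ _ (fun q => V1 q - V2 q + g q)).
    move=> q /[!inE] /KH /= q0; rewrite /f /g ger0_norm//.
  move=> q; exact: (@cvgD R R^o _ _ _ _ _ _ _ (@cvgB R R^o _ _ _ _ _ _ _ (c1 q) (c2 q)) (cg q)).
have [||c /[!inE] Kc cmax] := @compact_EVT_max V R f (half_cube r^-1) _ _ cf.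
- by exists p.
- exact: half_cube_compact.
apply: le_trans (_ : f c <= 0); first by apply: cmax; rewrite inE.
have [c1 c2] := Kc; move: c2; rewrite /= in_itv/= => /andP[c20 c21].
have t0 : 0 <= r * c.2 by rewrite mulr_ge0// ltW.
have t1 : r * c.2 <= 1 by rewrite mulrC -ler_pdivlMr// mul1r.
have X0 : 0 <= r ^+ 2 * normsq c.1 by rewrite mulr_ge0 ?sqr_ge0 ?normsq_ge0.
have tt : (r * c.2) ^+ 2 <= (r * c.2) `^ (2 * s).
  rewrite -powR_mulrn//; have [->|tn0] := eqVneq (r * c.2) 0.
    by rewrite !powR0 ?lt0r_neq0// mulr_gt0.
  apply: ger_powR; rewrite ?lt_neqAle ?t0 ?t1 ?(eq_sym 0) ?tn0//.
  by rewrite ler_piMr// ltW.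
have rt : 0 <= r * (1 - (r * c.2) ^+ 2) by rewrite mulr_ge0 ?(ltW r0)// subr_ge0 expr_le1.
(* Bottom face: the traces cancel, and what is left of [bar] is nonpositive. *)
have [c2z|c2pos] := eqVneq c.2 0.
  rewrite /f barE// (surjective_pairing c) c2z I1 I2 subrr mulr0 powR0 ?mulf_neq0 ?(lt0r_neq0 s0)//=.
  rewrite expr0n/= !mulr0 !subr0 addr0 mulr1 add0r -opprD oppr_le0 addr_ge0 ?(ltW r0)//.
  by rewrite mulr_ge0.
(* Lateral faces: the |x|^2 term alone reaches [M2], and [tt] makes the other terms nonnegative. *)
have [cb|cb] := ltP `|c.1| r^-1; last first.
  have X1 : 1 <= r ^+ 2 * normsq c.1.
    rewrite -enorm_sqr -exprMn exprn_ege1// mulrC -ler_pdivrMr// mul1r.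
    by apply: le_trans (norm_le_enorm _).
  have := bW c.1 c20; rewrite -surjective_pairing => bWc.
  rewrite /f barE//.
  have kt : 0 <= k * ((r * c.2) `^ (2 * s) - (r * c.2) ^+ 2) by rewrite mulr_ge0// subr_ge0.
  have := @powR_ge0 R (r * c.2) (2 * s).
  set P := _ `^ _ in kt tt *; set Q := _ ^+ 2 in kt tt rt *; set X := _ * normsq _ in X1 X0 * => P0.
  have : M2 * 1 <= M2 * (X + (1 + k) * P - k * Q) by rewrite ler_wpM2l//; nra.
  lra.
(* Top face, where [r * y = 1]: the correction vanishes and [(1 + k) - k = 1]. *)
have [ct|ct] := ltP c.2 r^-1; last first.
  have tE : r * c.2 = 1 by apply/eqP; rewrite eq_le t1/= mulrC -ler_pdivrMr// mul1r.
  have := bW c.1 c20; rewrite -surjective_pairing => bWc.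
  rewrite /f barE// tE powR1 expr1n subrr mulr0 oppr0 sub0r !mulr1.
  have : M2 * 1 <= M2 * (r ^+ 2 * normsq c.1 + (1 + k) - k) by rewrite ler_wpM2l//; lra.
  lra.
exfalso; apply: (@barrier_no_max V1 V2 (- r) (- (M2 * r ^+ 2)) (M2 * r ^+ 2 * (1 + k) + r ^+ 3)
  (- (M2 * (1 + k) * r `^ (2 * s))) c C1 C2 E1 E2).
(* By the choice of [k] all multiples of [M2] cancel; only the correction contributes. *)
- rewrite [ltRHS](_ : _ = r ^+ 3 * (2 - 2 * s)) ?mulr_gt0 ?exprn_gt0//.
  by rewrite /k; field; rewrite lt0r_neq0.
- by rewrite lt_neqAle eq_sym c2pos.
- have c20' : 0 < c.2 by rewrite lt_neqAle eq_sym c2pos.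
  near=> q; apply: cmax; rewrite inE; split => /=.
    apply: ltW; near: q; apply: (@cvgr_lt R V (nbhs c) _ (fun q => `|q.1|) `|c.1|) => //.
    by apply: (@continuous_comp _ _ _ (fst : V -> 'rV[R]_n) (fun x => `|x|) c); [exact: cvg_fst|exact: norm_continuous].
  rewrite in_itv/=; apply/andP; split; apply: ltW; near: q; first exact: near_half_space.
  by apply: (@cvgr_lt R V (nbhs c) _ snd c.2) => //; exact: cvg_snd.
Unshelve. all: by end_near. Qed.

Lemma extension_solution_le p : 0 <= p.2 -> V1 p <= V2 p.
Proof.
move=> p0; rewrite -subr_le0.
have pp : 0 <= `|p.1| + p.2 by rewrite addr_ge0.
(* An upper bound for [- bar r p], obtained by dropping its nonpositive terms. The point [p] lies in
   the half cube once [r] is small, and [g r] tends to 0 with [r]. *)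
pose g (r : R) := r + M2 * (r ^+ 2 * normsq p.1 + (1 + k) * ((r `^ (2 * s)) * p.2 `^ (2 * s))).
have ss : 0 < 2 * s by rewrite mulr_gt0.
have cr : (r : R) @[r --> 0^'+] --> (0 : R) by apply: cvg_at_right_filter; exact: cvg_id.
have cg : g r @[r --> 0^'+] --> 0 + M2 * (0 ^+ 2 * normsq p.1 + (1 + k) * (0 * p.2 `^ (2 * s))).
  apply: cvgD; first exact: cr.
  apply: cvgM; first exact: cvg_cst.
  apply: cvgD; first by apply: cvgM; [exact: (cvgM cr cr)|exact: cvg_cst].
  apply: cvgM; first exact: cvg_cst.
  by apply: cvgM; [exact: powR_cvg0|exact: cvg_cst].
have -> : 0 = 0 + M2 * (0 ^+ 2 * normsq p.1 + (1 + k) * (0 * p.2 `^ (2 * s))) :> R.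
  by rewrite expr0n/= !mul0r !(mulr0, addr0).
apply: (cvgr_to_ge cg); near=> r.
have r0 : 0 < r by near: r; exact: nbhs_right_gt.
have pr : `|p.1| + p.2 <= r^-1.
  have : r * (`|p.1| + p.2 + 1) <= 1.
    rewrite -ler_pdivlMr ?(ltr_wpDl pp)// mul1r; near: r; apply: nbhs_right_le.
    by rewrite invr_gt0 (ltr_wpDl pp).
  rewrite -[r^-1]mul1r ler_pdivlMr//; nra.
have Kp : half_cube r^-1 p.
  split; rewrite /= ?in_itv/=; first by apply: le_trans pr; rewrite lerDl.
  by rewrite p0/=; apply: le_trans pr; rewrite lerDr.
have := barrier_comparison r0 Kp; rewrite barE// powRM ?(ltW r0)// /g.
have : 0 <= k * (r * p.2) ^+ 2 by rewrite mulr_ge0 ?sqr_ge0.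
have : 0 <= r * (r * p.2) ^+ 2 by rewrite mulr_ge0 ?sqr_ge0 ?(ltW r0).
set Q := _ ^+ 2; set N := normsq _; set P := _ `^ _; set S := _ `^ _ => h1 h2.
have : 0 <= M2 * (k * Q) by rewrite mulr_ge0.
lra.
Unshelve. all: by end_near. Qed.

End uniqueness.

Set Implicit Arguments.
Unset Implicit Arguments.
Set Strict Implicit.

Theorem theorem10p1 (R : realType) (n : nat) (hn : (0 < n)%N) (s : R)
    (hs0 : 0 < s) (hs1 : s < 1) (u : 'rV[R]_n -> R) (hu : schwartz u) :
  let a := 1 - 2 * s in
  exists U : 'rV[R]_n * R -> R,
    [/\ extension_solution a u U /\ bounded_on_half_space U,
        forall V : 'rV[R]_n * R -> R,
          extension_solution a u V -> bounded_on_half_space V ->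
          forall (x : 'rV[R]_n) (y : R), 0 <= y -> V (x, y) = U (x, y),
        forall (x : 'rV[R]_n) (y : R), 0 < y ->
          U (x, y) = convolution (fun z => poisson_kernel s z y) u x &
        forall x : 'rV[R]_n,
          cvg (y `^ a * partial None U (x, y) @[y --> 0^'+]) /\
          fractional_laplacian s u x =
            - (2 `^ (2 * s - 1) * Gamma s / Gamma (1 - s)) *
            lim (y `^ a * partial None U (x, y) @[y --> 0^'+])].
Proof.
move=> a; exists (poisson_ext s u).
have sol : extension_solution a u (poisson_ext s u).
  split.
  - exact: poisson_ext_C2.
  - exact: poisson_ext_pde.
  - by apply: continuous_subspaceT; exact: poisson_ext_continuous.
  - exact: poisson_ext0.
  - exact: poisson_ext_cvg0.
have [M bU] := poisson_ext_bounded hs0 hu.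
split.
- by split => //; exists M => x y _; exact: bU.
(* The one-sided comparison is applied in both orders, which requires a common bound for the two
   solutions. *)
- move=> V solV [M' bV] x y y0; pose N := Num.max M M'.
  have bU' z t : 0 <= t -> `|poisson_ext s u (z, t)| <= N by move=> _; rewrite le_max bU.
  have bV' z t : 0 <= t -> `|V (z, t)| <= N by move=> t0; rewrite le_max bV// orbT.
  apply/eqP; rewrite eq_le (extension_solution_le hs0 hs1 solV sol bV' bU')//.
  exact: (extension_solution_le hs0 hs1 sol solV bU' bV').
- by move=> x y y0; rewrite (poisson_extE hs0 hu).
- move=> x; have h := flux_limit hs0 hs1 hu (x := x).
  split; first exact: (cvgP _ h).
  rewrite (cvg_lim _ h)// (flux_limitE hs0 hs1 hu) /fractional_laplacian.
  set I := integral_Rn _.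
  have G0 : Gamma s != 0 :> R by rewrite lt0r_neq0// Gamma_gt0.
  have p0 : (pi : R) `^ (n%:R / 2) != 0 by rewrite lt0r_neq0// powR_gt0// pi_gt0.
  have Gm : (n%:R + 2 * s) / 2 = n%:R / 2 + s by field.
  have two : 2 `^ (2 * s) = 2 * 2 `^ (2 * s - 1) :> R by rewrite mulr_powRB1 ?mulr_gt0.
  (* [G] is [Gamma s], [m] is [Gamma (n/2 + s)], [q] is [pi ^ (n/2)], [g] is [1 / Gamma (1 - s)] and
     [t] is [2 ^ (2 s - 1)]. The factor [Gamma s] of the theorem cancels the one in the
     normalisation of the Poisson kernel. *)
  have E (G m q g t : R) : G != 0 -> q != 0 ->
    s * (2 * t) * m * (q^-1 * g) / 2 * I = - (t * G * g) * (- (m / (q * G) * s) * I).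
    by move=> ? ?; field; apply/andP.
  by rewrite /gamma_ns Gm two (invfM (pi `^ _)); exact: E.
Qed.
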